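(* Let $G$ be a finite, simple, undirected, connected graph with minimum degree $\delta(G)=2$. Then $\gamma_t(G)\le a(G)+1$. Moreover, if $d^*(G)\ge 3$, then $\gamma_t(G)\le a(G)$. Here $\gamma_t(G)$ is the total domination number, $a(G)$ the annihilation number, and $d^*(G)$ the cutoff degree of $G$.
   Context: All graphs are finite, simple, undirected, and nontrivial (at least two vertices). For a graph $G$, $n(G)=|V(G)|$ and $m(G)=|E(G)|$ denote its order and size, and $\delta(G)$ its minimum degree. A set $D\subseteq V(G)$ is a total dominating set of $G$ if every vertex of $G$ (including those in $D$) is adjacent to a vertex of $D$; the total domination number $\gamma_t(G)$ is the minimum cardinality of a total dominating set of $G$. Let $d_1\le d_2\le\cdots\le d_{n(G)}$ be the nondecreasing degree sequence of $G$. The annihilation number of $G$ is $a(G)=\max\{k : \sum_{i=1}^{k} d_i\le m(G)\}$. For a connected nontrivial graph $G$ one has $a(G)\le n(G)-1$ (the sum of all degrees is $2m(G)>m(G)$), and the cutoff degree is defined by $d^*(G)=d_{a(G)+1}$. *)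

(* Defs.v *)
(* MathComp. A finite simple graph is a symmetric irreflexive relation e on a
   vertex type T : finType. *)
From mathcomp Require Import all_boot.

Set Implicit Arguments.
Unset Strict Implicit.
Unset Printing Implicit Defensive.

Definition simple_graph (T : finType) (e : rel T) : Prop :=
  symmetric e /\ irreflexive e.

Definition connected_graph (T : finType) (e : rel T) : Prop :=
  forall x y : T, connect e x y.

Definition edge_set (T : finType) (e : rel T) : {set {set T}} :=
  [set A : {set T} | [exists x, exists y, e x y && (A == [set x; y])]].

Definition graph_order (T : finType) (e : rel T) : nat := #|T|.

Definition graph_size (T : finType) (e : rel T) : nat := #|edge_set e|.

Definition degree (T : finType) (e : rel T) (x : T) : nat :=
  #|[set y | e x y]|.

(* The starting value #|T| bounds every degree, so for nonempty T this is the
   genuine minimum. *)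
Definition min_degree (T : finType) (e : rel T) : nat :=
  \big[minn/#|T|]_(x : T) degree e x.

Definition total_dominating (T : finType) (e : rel T) (D : {set T}) : bool :=
  [forall x : T, exists y in D, e x y].

(* The starting value #|T| bounds every #|D|, so this is the genuine minimum
   whenever a total dominating set exists, i.e. when no vertex is isolated. *)
Definition total_domination_number (T : finType) (e : rel T) : nat :=
  \big[minn/#|T|]_(D : {set T} | total_dominating e D) #|D|.

(* Indexed from 0: the entry of index i is d_(i+1). *)
Definition degree_seq (T : finType) (e : rel T) : seq nat :=
  sort leq [seq degree e x | x : T].

Definition annihilation_number (T : finType) (e : rel T) : nat :=
  \max_(k < (graph_order e).+1
       | \sum_(i < k) nth 0 (degree_seq e) i <= graph_size e) k.

(* The default 0 is never used when e has an edge: then the annihilation number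
   is at most #|T| - 1. *)
Definition cutoff_degree (T : finType) (e : rel T) : nat :=
  nth 0 (degree_seq e) (annihilation_number e).

(* Main.v *)
Require Import Defs.
From mathcomp Require Import all_boot zify.

(* Let n, m be the order and size of the graph, n2 the number of its vertices
   of degree 2, and g its total domination number.  Comparing the sum of the
   a + 1 smallest degrees with m reduces the theorem to three inequalities,
   used when the cutoff degree is 2, 3 and at least 4 respectively:
     2 g <= m + 2,   3 g <= m + n2,   4 g <= 2 n + n2.

   For the first one, give every vertex a level such that the root alone has
   level 0 and every other vertex has a neighbor one level below, with the sum
   of the levels maximal.  Vertices with no neighbor one level above are then
   pairwise nonadjacent (otherwise one of them could be moved above the other),
   so counting edges shows that there are at most m - n + 1 of them besides the
   root.  A vertex with neighbors one level below and one level above is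
   dominated both by the vertices of level 2, 3 mod 4 and by those of level
   0, 1 mod 4; repairing the other vertices in both sets yields two total
   dominating sets with at most m + 2 vertices altogether.

   The two other inequalities bound the transversal number of the hypergraph of
   open neighborhoods.  The last one follows Chvatal and McDiarmid.  The second
   one is an induction with weight 3 for each vertex, 5 for each edge of size 2,
   2 s - 3 for each edge of size s > 2 and 1 for each connected component; the
   neighborhood hypergraph of a connected graph has at most two components, and
   the resulting error term 2 is absorbed by divisibility by 4. *)

Set Implicit Arguments.
Unset Strict Implicit.
Unset Printing Implicit Defensive.

(** * The Chvatal-McDiarmid bound *)

Section Hypergraphs.

Variable V : finType.
Implicit Types (E F : {set {set V}}) (D W Y Z S K : {set V}) (f g h : {set V}).

Definition hitting E D : Prop :=
  {in E, forall f, exists2 v, v \in f & v \in D}.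

Definition star E x : {set {set V}} := [set f in E | x \in f].

Lemma in_cover E f x : f \in E -> x \in f -> x \in cover E.
Proof. by move=> fE xf; apply/bigcupP; exists f. Qed.

Lemma sub_cover E f : f \in E -> f \subset cover E.
Proof. by move=> fE; apply/subsetP => x; apply: in_cover. Qed.

Lemma cover_subset E F : F \subset E -> cover F \subset cover E.
Proof.
move=> /subsetP FE; apply/subsetP => x /bigcupP[f /FE fE xf].
exact: in_cover xf.
Qed.

Lemma star_subset E x : star E x \subset E.
Proof. by apply/subsetP => f; rewrite inE => /andP[]. Qed.

Lemma notin_cover_star E x : x \notin cover (E :\: star E x).
Proof.
apply/bigcupP => -[f]; rewrite !inE => /andP[+ fE] xf.
by rewrite fE xf.
Qed.

Lemma hitting_setD E F D1 D2 :
  hitting F D1 -> hitting (E :\: F) D2 -> hitting E (D1 :|: D2).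
Proof.
move=> h1 h2 f fE; have [fF|fF] := boolP (f \in F).
  by have [v vf vD] := h1 f fF; exists v; rewrite // inE vD.
have [|v vf vD] := h2 f; first by rewrite inE fF fE.
by exists v; rewrite // inE vD orbT.
Qed.

Lemma hitting_star E x : hitting (star E x) [set x].
Proof. by move=> f; rewrite inE => /andP[_ xf]; exists x; rewrite ?inE. Qed.

Lemma sum_setD E F (w : {set V} -> nat) : F \subset E ->
  \sum_(f in E) w f = \sum_(f in F) w f + \sum_(f in E :\: F) w f.
Proof. by move=> FE; rewrite (big_setID F) /= (setIidPr FE). Qed.

Lemma sum_setD1 E f (w : {set V} -> nat) : f \in E ->
  \sum_(g in E) w g = w f + \sum_(g in E :\ f) w g.
Proof. exact: big_setD1. Qed.

(** Only an inequality, because an edge obtained by shrinking or contracting may coincide with one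
    already present. *)
Lemma sum_setU1_le E f (w : {set V} -> nat) :
  \sum_(g in f |: E) w g <= w f + \sum_(g in E) w g.
Proof.
have [fE|fE] := boolP (f \in E); last by rewrite big_setU1.
by rewrite (setUidPr _) ?sub1set // leq_addl.
Qed.

Lemma card_cover_setD E F W : W \subset cover E ->
  [disjoint W & cover (E :\: F)] -> #|cover (E :\: F)| + #|W| <= #|cover E|.
Proof.
move=> WE dW.
have -> : #|cover (E :\: F)| + #|W| = #|cover (E :\: F) :|: W|.
  by rewrite cardsU setIC (disjoint_setI0 dW) cards0 subn0.
by apply: subset_leq_card; rewrite subUset WE cover_subset ?subsetDl.
Qed.

Lemma star_eq2 E f g x : f \in E -> g \in E -> f != g ->
  x \in f -> x \in g -> #|star E x| = 2 -> star E x = [set f; g].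
Proof.
move=> fE gE fg xf xg s2; apply/esym/eqP; rewrite eqEcard cards2 fg s2 andbT.
by rewrite subUset !sub1set !inE fE gE xf xg.
Qed.

Definition cm_weight (s : nat) : nat := 1 + (s == 2).

(* [F] can be removed from [E] at the expense of [D], while the vertices of [W]
   become uncovered. *)
Definition cm_reducible E : Prop :=
  exists F D W, [/\ F \subset E, F != set0, hitting F D,
    W \subset cover E /\ [disjoint W & cover (E :\: F)] &
    4 * #|D| <= #|W| + \sum_(f in F) cm_weight #|f| ].

Lemma cm_weight_gt0 E : #|E| <= \sum_(f in E) cm_weight #|f|.
Proof. by rewrite -sum1_card; apply: leq_sum => f _. Qed.

Lemma disjoint2_cover E F x y : x \notin cover (E :\: F) ->
  y \notin cover (E :\: F) -> [disjoint [set x; y] & cover (E :\: F)].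
Proof.
move=> hx hy; apply/pred0P => z /=; rewrite !inE.
by apply/negP => /andP[/orP[]/eqP-> ]; apply/negP.
Qed.

(** The reduction that puts the single vertex [x] into the hitting set. Every edge through [y]
    passes through [x]; with [y = x] only the loss of [x] itself is counted. *)
Lemma cm_reducible_vertex E x y : x \in cover E -> y \in cover E ->
  y \notin cover (E :\: star E x) ->
  4 <= #|[set x; y]| + \sum_(f in star E x) cm_weight #|f| ->
  cm_reducible E.
Proof.
move=> xE yE yN le4; exists (star E x), [set x], [set x; y]; split.
- exact: star_subset.
- case/bigcupP: xE => f fE xf; apply/set0Pn; exists f.
  by rewrite inE fE xf.
- exact: hitting_star.
- split; first by rewrite subUset !sub1set xE yE.
  by apply: disjoint2_cover => //; apply: notin_cover_star.
- by rewrite cards1 muln1.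
Qed.

(** The edge itself weighs 2. If [x] lies in no other edge, choosing [y] uncovers both vertices;
    otherwise choosing [x] uncovers [x] and removes a second edge. Either way the gain is at least
    4. *)
Lemma cm_reducible_pair E x y : [set x; y] \in E -> x != y -> cm_reducible E.
Proof.
move=> eE xy.
have xe : x \in [set x; y] by rewrite !inE eqxx.
have ye : y \in [set x; y] by rewrite !inE eqxx orbT.
have c2 : #|[set x; y]| = 2 by rewrite cards2 xy.
have [/eqP s1|s1] := boolP (#|star E x| == 1).
  apply: (@cm_reducible_vertex E y x); rewrite ?(in_cover eE) //.
    apply/bigcupP => -[f]; rewrite !inE => /andP[+ fE] xf; rewrite fE /= => yf.
    have /cards1P[g gs] : #|star E x| == 1 by apply/eqP.
    have : f \in star E x by rewrite inE fE xf.
    have : [set x; y] \in star E x by rewrite inE eE xe.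
    rewrite gs !inE => /eqP <- /eqP ff; by rewrite ff ye in yf.
  have -> : [set y; x] = [set x; y] by rewrite setUC.
  rewrite c2; rewrite (big_setD1 [set x; y]) ?inE ?eE ?eqxx ?orbT // c2.
  by rewrite /cm_weight eqxx.
apply: (@cm_reducible_vertex E x x);
  rewrite ?(in_cover eE) ?notin_cover_star //.
rewrite setUid cards1.
have eS : [set x; y] \in star E x by rewrite inE eE xe.
rewrite (sum_setD1 _ eS) c2.
have := cm_weight_gt0 (star E x :\ [set x; y]).
move: s1; rewrite (cardsD1 [set x; y] (star E x)) eS.
set k := #|_ :\ _|; set t := \sum_(_ in _) _.
have -> : cm_weight 2 = 2 by [].
by case: k => //; lia.
Qed.


(** * Paths in the intersection graph of the edges *)

Definition adjacent_edges E f g : bool :=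
  [&& f \in E, g \in E, f != g & f :&: g != set0].

Lemma consecutive_inj k l : (k == l) || (k == l.+1) ->
  (k.+1 == l) || (k.+1 == l.+1) -> k = l.
Proof. lia. Qed.

Lemma half_cases k : k = k./2.*2 \/ k = k./2.*2.+1.
Proof. lia. Qed.

(** By 2-regularity, a vertex shared by consecutive edges of the path lies in no other edge. On an
    initial segment of [L] edges these [L - 1] vertices, together with a vertex [w] shared by the
    edges 0 and [i], become uncovered, while every second one of them, [L / 2] in all, hits the
    segment: [4 * (L / 2) = L + L]. For even [i] the segment ends one edge past [i], which exists
    because of [j]. *)
Lemma cm_reducible_path E (s : seq {set V}) i j :
    {in E, forall f, #|f| = 3} -> {in cover E, forall x, #|star E x| = 2} ->
    uniq s -> {subset s <= E} -> sorted (adjacent_edges E) s ->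
    1 < i < j -> j < size s -> adjacent_edges E (nth set0 s 0) (nth set0 s i) ->
  cm_reducible E.
Proof.
move=> u3 d2 us sE path_s /andP[lt1i ltij] ltjs adj0i.
have memE k : k <= j -> nth set0 s k \in E.
  by move=> kj; apply/sE/mem_nth/(leq_ltn_trans kj).
have [v0 _] : exists v : V, v \in nth set0 s 0.
  by apply/set0Pn; rewrite -card_gt0 u3 //; apply: memE.
(* the even initial segment of the path that contains the chord (0, i) *)
pose h := i./2.+1; pose L := h.*2.
have iL : i < L by rewrite /L /h; lia.
have Lj : L <= j.+1 by rewrite /L /h; lia.
have Ls : L <= size s := leq_trans Lj ltjs.
pose e k := nth set0 s k.
have eE k : k < L -> e k \in E by move=> kL; apply: memE; lia.
have e_eq k l : k < L -> l < L -> (e k == e l) = (k == l).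
  by move=> kL lL; rewrite nth_uniq // (leq_trans _ Ls).
have adjS k : k.+1 < L -> adjacent_edges E (e k) (e k.+1).
  by move=> kL; move/(sortedP set0): path_s; apply; apply: leq_trans Ls.
pose c k := odflt v0 [pick v in e k :&: e k.+1].
have cP k : k.+1 < L -> (c k \in e k) && (c k \in e k.+1).
  move=> /adjS /and4P[_ _ _ /set0Pn[v hv]]; rewrite /c; case: pickP => [w|/(_ v)].
    by rewrite inE.
  by rewrite hv.
have /and4P[_ _ ne0i /set0Pn[w]] := adj0i; rewrite inE => /andP[w0 wi].
have st_c k : k.+1 < L -> star E (c k) = [set e k; e k.+1].
  move=> kL; have /andP[c1 c2] := cP k kL; have /and4P[ek ek' ne _] := adjS k kL.
  by apply: star_eq2 => //; rewrite d2 // (in_cover ek).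
have st_w : star E w = [set e 0; e i].
  have e0 : e 0 \in E by apply: eE; lia.
  by apply: star_eq2 => //; rewrite ?eE // d2 // (in_cover e0).
pose F := [set f in take L s]; pose D := [set c k.*2 | k : 'I_h].
pose W := w |: [set c k | k : 'I_L.-1].
have FE : F \subset E.
  by apply/subsetP => f; rewrite inE => /mem_take; apply: sE.
have eF k : k < L -> e k \in F.
  by move=> kL; rewrite inE /e -(@nth_take L) // mem_nth // size_takel.
have FP f : f \in F -> exists2 k, k < L & f = e k.
  rewrite inE => /(nthP set0)[k]; rewrite size_takel // => kL <-.
  by exists k; rewrite // /e nth_take.
have cardF : #|F| = L.
  by rewrite cardsE (card_uniqP _) ?take_uniq // size_takel.
have c_inj k l : k.+1 < L -> l.+1 < L -> c k = c l -> k = l.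
  move=> kL lL ckl; have := st_c k kL; rewrite ckl st_c // => /setP eqs.
  have [k'L l'L] : k < L /\ l < L by split; apply: ltnW.
  apply: consecutive_inj; have := eqs (e k); have := eqs (e k.+1).
    by rewrite !inE !e_eq // !eqxx.
  by rewrite !inE !e_eq // !eqxx orbT.
have ordL (k : 'I_L.-1) : k.+1 < L by case: k => k /= kL; clear -kL; lia.
exists F, D, W; split => //.
- by rewrite -card_gt0 cardF.
- move=> f /FP[k kL ->]; have kh : k./2 < h by rewrite /L in kL; clear -kL; lia.
  have /andP[c1 c2] : (c k./2.*2 \in e k./2.*2) && (c k./2.*2 \in e k./2.*2.+1).
    by apply: cP; rewrite /L; clear -kh; lia.
  exists (c k./2.*2); last by apply/imsetP; exists (Ordinal kh).
  by have [/(congr1 e)->|/(congr1 e)->] := half_cases k.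
- split.
    apply/subsetP => x; rewrite 2!inE => /orP[/eqP->|/imsetP[k _ ->]].
      by apply: in_cover w0; apply: (eE 0).
    have kL : k.+1 < L by apply: ordL.
    by have /andP[c1 _] := cP k kL; apply: in_cover c1; apply: eE; lia.
  rewrite disjoint_subset; apply/subsetP => x; rewrite 2!inE => xW.
  apply/bigcupP => -[f]; rewrite inE => /andP[fF fE] xf.
  have : f \in star E x by rewrite inE fE.
  case/orP: xW fF => [/eqP->|/imsetP[k _ ->]] fF.
    by rewrite st_w !inE => /orP[]/eqP ff; rewrite ff eF // in fF; lia.
  have kL : k.+1 < L by apply: ordL.
  by rewrite st_c // !inE => /orP[]/eqP ff; rewrite ff eF // in fF; lia.
- have cardD : #|D| <= h.
    by rewrite (leq_trans (leq_imset_card _ _)) // card_ord.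
  have cardW : #|W| = L.
    rewrite cardsU1 card_imset; last first.
      by move=> k l /c_inj ckl; apply/val_inj/ckl; apply: ordL.
    rewrite card_ord; suff -> : w \notin [set c k | k : 'I_L.-1] by lia.
    apply/imsetP => -[k _ wc].
    have kL : k.+1 < L by apply: ordL.
    have := st_w; rewrite wc st_c // => /setP eqs.
    have kL' : k < L := ltnW kL; have L0 : 0 < L by [].
    have := eqs (e 0); have := eqs (e i); rewrite !inE !e_eq // !eqxx /= orbT.
    by move: lt1i; clear; lia.
  have := cm_weight_gt0 F; rewrite cardF cardW /L; lia.
Qed.

(* A longest path in the intersection graph of the edges ends in an edge all
   of whose neighbors lie on the path. *)
Lemma cm_reducible_regular E : E != set0 ->
    {in E, forall f, #|f| = 3} -> {in cover E, forall x, #|star E x| = 2} ->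
    {in E &, forall f g, f != g -> #|f :&: g| <= 1} ->
  cm_reducible E.
Proof.
move=> /set0Pn[f0 f0E] u3 d2 linE.
(* Different vertices of [f] lead to different second edges, as two edges share at most one
   vertex. *)
have deg3 f : f \in E -> 2 < #|[set g | adjacent_edges E f g]|.
  move=> fE; suff : #|f| <= #|[set g | adjacent_edges E f g]| by rewrite u3.
  pose other x := odflt set0 [pick g in star E x | g != f].
  have otherP x : x \in f -> (other x \in star E x) && (other x != f).
    move=> xf; rewrite /other; case: pickP => [//|noG].
    have: #|star E x :\ f| = 1.
      by have := d2 x (in_cover fE xf); rewrite (cardsD1 f) inE fE xf => -[].
    move=> c1; have /card_gt0P[g] : 0 < #|star E x :\ f| by rewrite c1.
    by rewrite in_setD1 andbC noG.
  rewrite -(card_in_imset (f := other) (D := f)).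
    apply: subset_leq_card; apply/subsetP => g /imsetP[x xf ->].
    have /andP[] := otherP x xf; rewrite !inE => /andP[oE xo] of_.
    by rewrite /adjacent_edges fE oE eq_sym of_; apply/set0Pn; exists x; rewrite inE xf.
  move=> x y xf yf oxy; apply/eqP; apply: contraT => xy.
  have /andP[] := otherP x xf; rewrite inE => /andP[oE xo] of_.
  have /andP[] := otherP y yf; rewrite inE -oxy => /andP[_ yo] _.
  have := linE f (other x) fE oE; rewrite eq_sym => /(_ of_).
  rewrite leqNgt => /negP[]; apply: leq_trans (_ : #|[set x; y]| <= _).
    by rewrite cards2 xy.
  by apply: subset_leq_card; rewrite subUset !sub1set !inE xf yf xo yo.
(* The path grows at its head [f] until all neighbors of [f] lie on it; [n] exceeds the number of
   edges off the path. *)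
have ext n s : #|E| - size s < n -> 0 < size s -> uniq s ->
    {subset s <= E} -> sorted (adjacent_edges E) s -> cm_reducible E.
  elim: n s => [//|n IHn] [//|f s] les _ us sE path_s.
  have fE : f \in E by apply: sE; rewrite mem_head.
  have [/existsP[g /andP[fg gs]]|/existsPn all_nbr] :=
    boolP [exists g, adjacent_edges E f g && (g \notin f :: s)].
    have /and4P[_ gE ne ned] := fg.
    have gsE : {subset g :: f :: s <= E}.
      by move=> h; rewrite inE => /orP[/eqP->|/sE].
    have ugs : uniq (g :: f :: s) by rewrite cons_uniq gs.
    apply: (IHn (g :: f :: s)) => //=; last first.
      by rewrite /adjacent_edges gE fE eq_sym ne setIC ned.
    have : size (g :: f :: s) <= #|E|.
      by rewrite -(card_uniqP ugs); apply/subset_leq_card/subsetP.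
    by move: les => /=; clear; lia.
  have in_s g : adjacent_edges E f g -> g \in s.
    move=> fg; have := all_nbr g; rewrite fg /= negbK inE => /orP[/eqP gf|//].
    by move: fg; rewrite /adjacent_edges gf eqxx /= !andbF.
  pose v1 := nth set0 (f :: s) 1.
  (* Besides its successor [v1], the head has two further neighbors on the path; their positions
     serve as [i < j] in [cm_reducible_path]. *)
  have : 1 < #|[set g | adjacent_edges E f g] :\ v1|.
    by have := deg3 f fE; rewrite (cardsD1 v1); case: (v1 \in _); lia.
  move=> /card_gt1P[g [h []]]; rewrite !inE => gP hP gh.
  pose idx (g : {set V}) := index g (f :: s).
  have idxP a : (a != v1) && adjacent_edges E f a ->
      [/\ 1 < idx a, idx a < (size s).+1 & nth set0 (f :: s) (idx a) = a].
    move=> /andP[a1 fa]; have as_ : a \in f :: s by rewrite inE in_s ?orbT.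
    have na : nth set0 (f :: s) (idx a) = a by apply: nth_index.
    split; rewrite ?index_mem // ltnNge; apply/negP => le1.
    have [id0|id1] : idx a = 0 \/ idx a = 1 by case: (idx a) le1 => [|[|]]; auto.
      by move: fa; rewrite -na id0 /adjacent_edges eqxx /= !andbF.
    by move: a1; rewrite -na id1 eqxx.
  have [g1 gs ng] := idxP g gP; have [h1 hs nh] := idxP h hP.
  have /andP[_ fg] := gP; have /andP[_ fh] := hP.
  have ne : idx g != idx h by apply: contra_neq gh => eqi; rewrite -ng -nh eqi.
  have [ltgh|lthg] := orP (etrans (esym (neq_ltn _ _)) ne).
    apply: (@cm_reducible_path E (f :: s) (idx g) (idx h)) => //.
      by rewrite g1.
    by rewrite ng.
  apply: (@cm_reducible_path E (f :: s) (idx h) (idx g)) => //.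
    by rewrite h1.
  by rewrite nh.
apply: (ext #|E|.+1 [:: f0]) => //.
  by rewrite ltnS leq_subr.
by move=> f; rewrite inE => /eqP->.
Qed.

(** Each configuration excluded in turn is reducible: an edge of size 2, a vertex of degree at least
    3, a vertex of degree 2 whose removal uncovers another vertex, an edge all of whose vertices
    have degree 1. What remains is 3-uniform and 2-regular, and two edges sharing two vertices would
    give the third configuration. *)
Lemma cm_irreducible E : E != set0 -> {in E, forall f, 1 < #|f| <= 3} ->
  cm_reducible E.
Proof.
move=> E0 sz.
have [/existsP[f /andP[fE /cards2P[x [y [xy fxy]]]]]|/existsPn no2] :=
  boolP [exists f in E, #|f| == 2].
  by rewrite fxy in fE; apply: cm_reducible_pair fE xy.
have u3 : {in E, forall f, #|f| = 3}.
  by move=> f fE; have := sz f fE; have := no2 f; rewrite fE /=; lia.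
have [/existsP[x /andP[xE d3]]|/existsPn le2] :=
  boolP [exists x in cover E, 2 < #|star E x|].
  apply: (@cm_reducible_vertex E x x) => //; first exact: notin_cover_star.
  by rewrite setUid cards1; have := cm_weight_gt0 (star E x); lia.
have deg1 x f : f \in E -> x \in f -> 0 < #|star E x|.
  by move=> fE xf; apply/card_gt0P; exists f; rewrite inE fE.
have [/existsP[x /andP[d2 /existsP[y /and3P[xy yE yN]]]]|/existsPn noiso] :=
  boolP [exists x, (#|star E x| == 2) && [exists y, [&& x != y, y \in cover E &
     y \notin cover (E :\: star E x)]]].
  apply: (@cm_reducible_vertex E x y) => //.
    have /card_gt0P[f] : 0 < #|star E x| by rewrite (eqP d2).
    by rewrite inE => /andP[]; apply: in_cover.
  by rewrite cards2 xy; have := cm_weight_gt0 (star E x); rewrite (eqP d2); lia.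
have [/existsP[f /andP[fE /forall_inP iso]]|/existsPn nonisolated] :=
  boolP [exists f in E, [forall x in f, #|star E x| == 1]].
  have /card_gt0P[x xf] : 0 < #|f| by rewrite u3.
  exists [set f], [set x], f; split.
  - by rewrite sub1set.
  - by apply/set0Pn; exists f; rewrite inE.
  - by move=> g; rewrite inE => /eqP->; exists x; rewrite ?inE.
  - split; first exact: sub_cover.
    rewrite disjoint_subset; apply/subsetP => y yf; rewrite inE.
    apply/bigcupP => -[g]; rewrite !inE => /andP[gf gE] yg.
    have /cards1P[h hs] := iso y yf.
    have : f \in star E y by rewrite inE fE.
    have : g \in star E y by rewrite inE gE.
    by rewrite hs !inE => /eqP gh /eqP fh; rewrite gh fh eqxx in gf.
  - by have := cm_weight_gt0 [set f]; rewrite !cards1 u3 //; lia.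
have deg_le x f : f \in E -> x \in f -> #|star E x| <= 2.
  by move=> fE xf; have := le2 x; rewrite (in_cover fE xf) /= -leqNgt.
have nbr2 x y f : f \in E -> x \in f -> y \in f -> x != y -> #|star E x| = 2 ->
    #|star E y| = 2 /\ exists2 g, g \in star E y & g \notin star E x.
  move=> fE xf yf xy d2; have := noiso x; rewrite d2 eqxx /= => /existsPn/(_ y).
  rewrite xy (in_cover fE yf) /= negbK => /bigcupP[g]; rewrite inE.
  move=> /andP[gN gE] yg; have gy : g \in star E y by rewrite inE gE.
  split; last by exists g.
  apply/eqP; rewrite eqn_leq (deg_le y f) //.
  have <- : #|[set f; g]| = 2.
    by rewrite cards2; case: eqP gN => // <-; rewrite inE fE xf.
  by apply: subset_leq_card; rewrite subUset !sub1set gy inE fE yf.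
have deg2 : {in cover E, forall x, #|star E x| = 2}.
  move=> y /bigcupP[f fE yf].
  have := nonisolated f; rewrite fE /= => /forall_inPn[x xf d1].
  have dx : #|star E x| = 2.
    by move: d1 (deg1 x f fE xf) (deg_le x f fE xf); case: #|star E x| => [|[|[|]]].
  by have [<-//|xy] := eqVneq x y; have [] := nbr2 x y f fE xf yf xy dx.
apply: cm_reducible_regular => // f g fE gE fg; rewrite leqNgt.
apply/negP => /card_gt1P[x [y []]]; rewrite !inE => /andP[xf xg] /andP[yf yg] xy.
have dx := deg2 x (in_cover fE xf); have dy := deg2 y (in_cover fE yf).
have [_ [h]] := nbr2 x y f fE xf yf xy dx.
rewrite (star_eq2 fE gE fg yf yg dy) (star_eq2 fE gE fg xf xg dx).
by move->.
Qed.

Lemma sum_card_setD E F : {in E, forall f, 1 < #|f|} -> F \subset E -> F != set0 ->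
  \sum_(f in E :\: F) #|f| < \sum_(f in E) #|f|.
Proof.
move=> sz FE /set0Pn[f fF]; rewrite (sum_setD _ FE) -[ltnLHS]add0n ltn_add2r.
by rewrite (sum_setD1 _ fF) ltn_addr // ltnW // sz // (subsetP FE).
Qed.

Theorem hitting_cm E : {in E, forall f, 1 < #|f|} ->
  exists2 D, hitting E D &
    4 * #|D| <= #|cover E| + \sum_(f in E) cm_weight #|f|.
Proof.
have [n] := ubnP (\sum_(f in E) #|f|); elim: n E => // n IHn E ltn sz.
have [->|E0] := eqVneq E set0.
  by exists set0; [move=> f; rewrite inE | rewrite cards0].
have [/existsP[f /andP[fE f4]]|/existsPn le3] := boolP [exists f in E, 3 < #|f|].
  (* An edge of size at least 4 keeps weight 1 after losing a vertex, so it may be shrunk. *)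
  have /card_gt0P[y yf] : 0 < #|f| by lia.
  have cf : #|f :\ y| = #|f|.-1 by rewrite (cardsD1 y f) yf.
  have fsub : [set f] \subset E by rewrite sub1set.
  have [||D hD leD] := IHn (f :\ y |: E :\ f).
  - apply: leq_ltn_trans (sum_setU1_le _ _ _) _; move: ltn.
    by rewrite (sum_setD _ fsub) big_set1 cf; lia.
  - move=> g; rewrite inE => /orP[/set1P->|/setD1P[_ /sz]//].
    by rewrite cf; lia.
  exists D.
    move=> g gE; have [->|gf] := eqVneq g f; last by apply: hD; rewrite !inE gf gE orbT.
    have [|v vf vD] := hD (f :\ y); first by rewrite inE inE eqxx.
    by exists v; rewrite //; move: vf; rewrite inE => /andP[].
  apply: leq_trans leD _; apply: leq_add.
    apply: subset_leq_card; apply/bigcupsP => g; rewrite inE.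
    case/orP=> [/set1P->|/setD1P[_ /sub_cover//]].
    by apply: subset_trans (sub_cover fE); apply: subsetDl.
  rewrite (sum_setD _ fsub) big_set1.
  apply: leq_trans (sum_setU1_le _ _ (fun g => cm_weight #|g|)) _.
  by rewrite leq_add2r cf /cm_weight; lia.
have [|F [D1 [W [FE F0 hF [WE dW] le4]]]] := @cm_irreducible E E0.
  by move=> f fE; rewrite sz //=; have := le3 f; rewrite fE /=; lia.
have [||D2 h2 le2] := IHn (E :\: F).
- exact: leq_trans (sum_card_setD sz FE F0) _.
- by move=> f /setDP[/sz].
exists (D1 :|: D2); first exact: hitting_setD hF h2.
have := card_cover_setD WE dW; have := leq_card_setU D1 D2.
by rewrite (sum_setD _ FE) => -[leU _]; lia.
Qed.

End Hypergraphs.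

(** * The bound counting components *)

Section Marks.

Variable V : finType.
Implicit Types (E F : {set {set V}}) (D W Y Z S K : {set V}) (f g h : {set V}).

(** * Connected components of a hypergraph *)

Definition edge_closed E S : bool :=
  [forall f in E, [disjoint f & S] || (f \subset S)].

Lemma edge_closedP E S :
  reflect {in E, forall f v, v \in f -> v \in S -> f \subset S} (edge_closed E S).
Proof.
apply: (iffP forall_inP) => [cS f fE v vf vS|cS f fE].
  by case/orP: (cS f fE) => // /disjointFr/(_ vf); rewrite vS.
have [//|/pred0Pn[v /andP[/= vf vS]]] := boolP [disjoint f & S].
by rewrite (cS f fE v vf vS).
Qed.

Lemma edge_closedC E S : edge_closed E S -> edge_closed E (~: S).
Proof.
move=> /edge_closedP cS; apply/edge_closedP => f fE v vf; rewrite inE => vS.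
apply/subsetP => u uf; rewrite inE; apply: contra vS => uS.
exact: subsetP (cS f fE u uf uS) v vf.
Qed.

Definition component E x : {set V} :=
  \bigcap_(S : {set V} | edge_closed E S && (x \in S)) S.

Lemma component_refl E x : x \in component E x.
Proof. by apply/bigcapP => S /andP[]. Qed.

Lemma component_closed E x : edge_closed E (component E x).
Proof.
apply/edge_closedP => f fE v vf /bigcapP vK; apply/bigcapsP => S cxS.
by have /andP[/edge_closedP cS _] := cxS; apply: (cS f fE v vf); apply: vK.
Qed.

Lemma component_min E x S : edge_closed E S -> x \in S -> component E x \subset S.
Proof. by move=> cS xS; apply: bigcap_inf; rewrite cS. Qed.

(** Complements of closed sets are closed: if [x] were outside [component E y], the complement of
    the latter would contain [component E x] and hence [y]. *)
Lemma component_eq E x y : y \in component E x -> component E y = component E x.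
Proof.
move=> yx; apply/eqP; rewrite eqEsubset component_min ?component_closed //=.
rewrite component_min ?component_closed //; apply: contraT => xy.
have := component_min (edge_closedC (component_closed E y)) (x := x).
by rewrite inE xy => /(_ isT)/subsetP/(_ y yx); rewrite inE component_refl.
Qed.

(* [Y] meets every connected component of [E]. *)
Definition marks E Y : Prop :=
  forall S, edge_closed E S -> Y \subset S -> cover E \subset S.

(** The component of [x] contains some mark [y], since otherwise its complement would be a closed
    set containing all marks; [y] is then traded for [x]. So any covered vertex may be assumed to be
    marked. *)
Lemma marks_rebase E Y x : marks E Y -> x \in cover E ->
  exists Y', [/\ x \in Y', marks E Y' & #|Y'| <= #|Y|].
Proof.
move=> mY xE; have cx := component_closed E x.
have [y yK yY] : exists2 y, y \in component E x & y \in Y.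
  apply/exists_inP; apply: contraT => /exists_inPn noY.
  have /subsetP/(_ x xE) : cover E \subset ~: component E x.
    apply: mY (edge_closedC cx) _; apply/subsetP => y yY; rewrite inE.
    by apply/negP => /noY; rewrite yY.
  by rewrite inE component_refl.
exists (x |: Y :\ y); split; first by rewrite !inE eqxx.
  move=> S cS; rewrite subUset sub1set => /andP[xS /subsetP YS].
  apply: mY => //; apply/subsetP => z zY; have [->|zy] := eqVneq z y.
    exact: subsetP (component_min cS xS) y yK.
  by apply: YS; rewrite !inE zy.
by rewrite (cardsD1 y Y) yY cardsU1 leq_add2r; case: (_ \notin _).
Qed.

(** Chosen so that 3 plus the weight of [d] is [2 d] for [d > 2] and [2 d + 4] for [d = 2]. For the
    neighborhoods of a graph of size [m] with minimum degree 2 and [n2] vertices of degree 2, the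
    potential is thus at most [4 m + 4 n2]. *)
Definition mark_weight (s : nat) : nat := if s == 2 then 5 else 2 * s - 3.

Definition potential E : nat :=
  3 * #|cover E| + \sum_(f in E) mark_weight #|f|.

Definition mark_bound E Y : Prop :=
  exists2 D, hitting E D & 12 * #|D| <= potential E + #|Y|.

Definition mark_bound_below n : Prop := forall E Y,
  \sum_(f in E) #|f| < n -> {in E, forall f, 1 < #|f|} -> marks E Y ->
  mark_bound E Y.

Lemma mark_bound_le E Y Y' : #|Y'| <= #|Y| -> mark_bound E Y' -> mark_bound E Y.
Proof.
by move=> leY [D hD leD]; exists D => //; apply: leq_trans leD _; rewrite leq_add2l.
Qed.

Definition nbrs E x : {set V} := cover (star E x) :\ x.

Lemma nbrsP E x y : reflect (exists2 f, f \in star E x & y \in f :\ x) (y \in nbrs E x).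
Proof.
apply: (iffP setD1P) => [[yx /bigcupP[f fE yf]]|[f fE /setD1P[yx yf]]].
  by exists f; rewrite // !inE yx.
by split=> //; apply/bigcupP; exists f.
Qed.

Lemma card_nbrs E x : #|nbrs E x| <= \sum_(f in star E x) #|f|.-1.
Proof.
have -> : nbrs E x = \bigcup_(f in star E x) (f :\ x).
  by apply/setP => y; apply/nbrsP/bigcupP.
have cf f : f \in star E x -> #|f|.-1 = #|f :\ x|.
  by rewrite inE => /andP[_ xf]; rewrite (cardsD1 x f) xf.
rewrite (eq_bigr _ cf); elim/big_rec2: _ => [|f m A _ le]; first by rewrite cards0.
by apply: leq_trans (leq_card_setU _ _).1 _; rewrite leq_add2l.
Qed.

(** Let [S] be closed in the smaller hypergraph and contain the new marks. Adding all vertices not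
    covered any more makes it closed in [E], because the surviving neighbors of [x] lie in [S]; then
    the old marks apply. *)
Lemma marks_delete E Y Z x : marks E Y ->
    (forall S, edge_closed (E :\: star E x) S -> Z \subset S ->
       nbrs E x :&: cover (E :\: star E x) \subset S) ->
  marks (E :\: star E x) (Y :\ x :|: Z).
Proof.
set E' := E :\: _ => mY hZ S cS; rewrite subUset => /andP[/subsetP YS /(hZ S cS)/subsetP nS].
have xE' : x \notin cover E' := notin_cover_star E x.
have cS' : edge_closed E (S :|: ~: cover E').
  apply/edge_closedP => f fE v vf vS; apply/subsetP => u uf; rewrite in_setU in_setC.
  case: (boolP (u \in cover E')) => [uE'|_]; last by rewrite orbT.
  rewrite orbF.
  have [xf|xf] := boolP (x \in f).
    apply: nS; rewrite inE uE' andbT; apply/nbrsP; exists f; rewrite !inE ?fE //.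
    by rewrite uf andbT; apply: contraNneq xE' => <-.
  have fE' : f \in E' by rewrite !inE fE (negPf xf).
  move: vS; rewrite !inE (in_cover fE' vf) orbF => vS.
  exact: subsetP (edge_closedP _ _ cS f fE' v vf vS) u uf.
have /subsetP ES : cover E \subset S :|: ~: cover E'.
  apply: mY => //; apply/subsetP => y yY; rewrite !inE.
  have [->|yx] := eqVneq y x; first by rewrite xE' orbT.
  by rewrite YS // !inE yx.
apply/subsetP => v vE'; have := ES v (subsetP (cover_subset (subsetDl _ _)) v vE').
by rewrite !inE vE' orbF.
Qed.

Lemma sum_star_lt E x : {in E, forall f, 1 < #|f|} -> x \in cover E ->
  \sum_(f in E :\: star E x) #|f| < \sum_(f in E) #|f|.
Proof.
move=> sz /bigcupP[f fE xf]; apply: sum_card_setD (star_subset E x) _ => //.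
by apply/set0Pn; exists f; rewrite inE fE.
Qed.

Lemma potential_delete E x : x \in cover E ->
  potential (E :\: star E x) + 3 + 3 * #|nbrs E x :\: cover (E :\: star E x)|
    + \sum_(f in star E x) mark_weight #|f| <= potential E.
Proof.
move=> xE; set E' := E :\: star E x; set I := nbrs E x :\: cover E'.
have xI : x \notin I by rewrite !inE eqxx andbF.
have := @card_cover_setD V E (star E x) (x |: I).
rewrite cardsU1 xI /potential (sum_setD _ (star_subset E x)) -/E'.
have -> : x |: I \subset cover E.
  rewrite subUset sub1set xE /=; apply/subsetP => y /setDP[/nbrsP[f]].
  by rewrite inE => /andP[fE _] /setD1P[_ /(in_cover fE)].
have -> : [disjoint x |: I & cover E'].
  rewrite disjoint_subset; apply/subsetP => y; rewrite !inE => /orP[/eqP->|].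
    exact: notin_cover_star.
  by case/andP.
by move=> /(_ isT isT); lia.
Qed.

(** Putting [x] into the hitting set costs 12. Uncovering [x] returns 3, and moving a mark to [x]
    and dropping it returns 1, which leaves 8. *)
Lemma mark_bound_delete E Y Z x : {in E, forall f, 1 < #|f|} ->
    mark_bound_below (\sum_(f in E) #|f|) -> marks E Y -> x \in cover E ->
    (forall S, edge_closed (E :\: star E x) S -> Z \subset S ->
       nbrs E x :&: cover (E :\: star E x) \subset S) ->
    8 + #|Z| <= 3 * #|nbrs E x :\: cover (E :\: star E x)|
                + \sum_(f in star E x) mark_weight #|f| ->
  mark_bound E Y.
Proof.
move=> sz IH mY xE hZ le8.
have [Y1 [xY mY1 leY]] := marks_rebase mY xE; apply: mark_bound_le leY _.
have [|||D hD leD] := IH (E :\: star E x) (Y1 :\ x :|: Z).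
- exact: sum_star_lt.
- by move=> f /setDP[/sz].
- exact: marks_delete.
exists ([set x] :|: D); first by apply: hitting_setD hD; apply: hitting_star.
have := potential_delete xE; have := (leq_card_setU [set x] D).1.
have := (leq_card_setU (Y1 :\ x) Z).1; rewrite cards1 (cardsD1 x Y1) xY.
by move: leD le8; clear; lia.
Qed.

Lemma mark_weight_ge s : 1 < s -> s <= mark_weight s.
Proof. by rewrite /mark_weight; case: eqP; lia. Qed.

Lemma sum_mark_weight_ge E : {in E, forall f, 1 < #|f|} ->
  \sum_(f in E) #|f|.-1 + #|E| <= \sum_(f in E) mark_weight #|f|.
Proof.
move=> sz; rewrite -[#|E|]sum1_card -big_split; apply: leq_sum => f fE.
by rewrite /= addn1 prednK ?mark_weight_ge ?sz // ltnW ?sz.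
Qed.

Lemma mark_bound_belowW n m : m <= n -> mark_bound_below n -> mark_bound_below m.
Proof. by move=> mn IH E Y lt; apply: IH; apply: leq_trans mn. Qed.

(* Induction gives [12 * #|D| <= potential E + 1] for some [D], and
   [12 * #|D| <= potential E + 8] for some [D] containing [z]; since [12 * #|D|]
   is a multiple of 12, one of the two improves as stated. *)
Lemma component_dichotomy E z : {in E, forall f, 1 < #|f|} ->
    mark_bound_below (\sum_(f in E) #|f|).+1 -> marks E [set z] ->
    z \in cover E ->
  (exists2 D, hitting E D & 12 * #|D| + 3 <= potential E) \/
  (exists D, [/\ hitting E D, z \in D & 12 * #|D| <= potential E + 1]).
Proof.
move=> sz IH mz zE; have [|D1 h1] := IH E [set z] _ sz mz; first by [].
rewrite cards1 => le1.
(* Forcing [z] costs 12 and one mark per neighbor; [z] returns 3, and the edges at [z] weigh at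
   least one more than these marks, which leaves 8. *)
have [|||D2 h2 le2] := IH (E :\: star E z) ([set z] :\ z :|: nbrs E z).
- by apply: leqW; apply: sum_star_lt.
- by move=> f /setDP[/sz].
- by apply: marks_delete => // S _ nS; apply: subset_trans nS; apply: subsetIl.
have hD := hitting_setD (@hitting_star _ E z) h2.
have zD : z \in [set z] :|: D2 by rewrite !inE eqxx.
have cD : #|[set z] :|: D2| <= 1 + #|D2|.
  by have := (leq_card_setU [set z] D2).1; rewrite cards1.
have cZ : #|[set z] :\ z :|: nbrs E z| <= #|nbrs E z|.
  by rewrite setDv set0U.
have cs : 0 < #|star E z|.
  by case/bigcupP: zE => f fE zf; apply/card_gt0P; exists f; rewrite inE fE.
have szs : {in star E z, forall f, 1 < #|f|}.
  by move=> f; rewrite inE => /andP[/sz].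
have := sum_mark_weight_ge szs; have := potential_delete zE.
have := card_nbrs E z; move: le1 le2 cD cZ cs hD zD.
move: (_ :|: D2) => D3; move: (\sum_(f in star E z) _) (\sum_(f in star E z) _).
move=> s1 s2 le1 le2 cD cZ cs hD zD cN leP leS.
have [le3|gt3] := leqP (12 * #|D1| + 3) (potential E); first by left; exists D1.
(* Here [12 * #|D1|] is at least [potential E - 2], so the next multiple of 12 exceeds
   [potential E + 8]; hence [#|D3| <= #|D1|]. *)
right; exists D3; split=> //.
by move: le1 le2 cD cZ cs cN leP leS gt3; clear; lia.
Qed.

(* A piece [K] of the hypergraph attached through the single vertex [z] of the
   single edge [f] can be cut off, with or without [f] according to
   [component_dichotomy]. *)
Lemma mark_bound_cut E Y K f z : {in E, forall g, 1 < #|g|} ->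
    mark_bound_below (\sum_(g in E) #|g|) -> marks E Y ->
    f \in E -> f :&: K = [set z] ->
    {in E :\ f, forall g, (g \subset K) || [disjoint g & K]} ->
    marks [set g in E | g \subset K] [set z] ->
    z \in cover [set g in E | g \subset K] ->
  mark_bound E Y.
Proof.
set C := [set g in E | _] => sz IH mY fE fK gK mC zC.
have /setIP[zf zK] : z \in f :&: K by rewrite fK set11.
have zE : z \in cover E := in_cover fE zf.
have CE : C \subset E by apply/subsetP => g; rewrite inE => /andP[].
have fC : f \notin C.
  rewrite inE fE; apply/negP => /setIidPl fK'.
  by have := sz f fE; rewrite -fK' fK cards1.
have fN : f \in E :\: C by rewrite inE fC fE.
have C0 : C != set0.
  by case/bigcupP: zC => g gC _; apply/set0Pn; exists g.
have szC : {in C, forall g, 1 < #|g|} by move=> g /(subsetP CE)/sz.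
have szN : {in E :\: C, forall g, 1 < #|g|} by move=> g /setDP[/sz].
have szR : {in (E :\: C) :\ f, forall g, 1 < #|g|} by move=> g /setD1P[_ /szN].
have ltC : \sum_(g in C) #|g| < \sum_(g in E) #|g|.
  rewrite (sum_setD _ CE) -[ltnLHS]addn0 ltn_add2l (sum_setD1 _ fN).
  by rewrite ltn_addr // ltnW // sz.
have ltN := sum_card_setD sz CE C0.
have coverC : cover C \subset K by apply/bigcupsP => g; rewrite inE => /andP[].
have RK g : g \in (E :\: C) :\ f -> [disjoint g & K].
  rewrite !inE => /and3P[gf gC gE]; have := gK g; rewrite !inE gf gE => /(_ isT).
  by move: gC; rewrite gE /= => /negPf->.
have coverR v : v \in cover ((E :\: C) :\ f) -> v \notin K.
  by case/bigcupP => g /RK/disjointFr dg /dg->.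
have [Y1 [zY mY1 leY]] := marks_rebase mY zE; apply: mark_bound_le leY _.
case: (component_dichotomy szC _ mC zC) => [|[D1 h1 le1]|[D1 [h1 zD1 le1]]].
- exact: mark_bound_belowW IH.
(* The slack 3 pays for [z], the only vertex that the piece can share with the rest; the rest keeps
   [f]. *)
- have [|D2 h2 le2] := IH (E :\: C) Y1 ltN szN.
    move=> S cS YS; have zS : z \in S := subsetP YS z zY.
    have cSK : edge_closed E (S :|: K).
      apply/edge_closedP => g gE v vg vSK; have [gC|gC] := boolP (g \in C).
        by apply: subset_trans (subsetUr _ _); move: gC; rewrite inE => /andP[].
      apply: subset_trans (subsetUl _ _).
      have gN : g \in E :\: C by rewrite inE gC.
      have [gf|gf] := eqVneq g f.
        by rewrite gf; apply: (edge_closedP _ _ cS f fN z).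
      have gR : g \in (E :\: C) :\ f by rewrite in_setD1 gf.
      apply: (edge_closedP _ _ cS g gN v) => //; move: vSK; rewrite inE.
      by rewrite (negPf (coverR v (in_cover gR vg))) orbF.
    have := mY1 _ cSK (subset_trans YS (subsetUl _ _)) => ESK.
    apply/subsetP => v vN; have [vK|vK] := boolP (v \in K).
      case/bigcupP: vN => g gN vg; have [gf|gf] := eqVneq g f.
        have : v \in f :&: K by rewrite inE -gf vg.
        by rewrite fK inE => /eqP->.
      have gR : g \in (E :\: C) :\ f by rewrite in_setD1 gf.
      by have := coverR v (in_cover gR vg); rewrite vK.
    have := subsetP ESK v (subsetP (cover_subset (subsetDl _ _)) v vN).
    by rewrite inE (negPf vK) orbF.
  exists (D1 :|: D2); first exact: hitting_setD h1 h2.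
  have : #|cover C| + #|cover (E :\: C)| <= #|cover E| + 1.
    rewrite -cardsUI leq_add //.
      by apply: subset_leq_card; rewrite subUset !cover_subset ?subsetDl.
    rewrite -(cards1 z) subset_leq_card //; apply/subsetP => v /setIP[vC].
    case/bigcupP => g gN vg; have [gf|gf] := eqVneq g f.
      by rewrite -fK inE -gf vg (subsetP coverC).
    have gR : g \in (E :\: C) :\ f by rewrite in_setD1 gf.
    by have := coverR v (in_cover gR vg); rewrite (subsetP coverC).
  have := (leq_card_setU D1 D2).1; move: le1 le2; rewrite /potential (sum_setD _ CE).
  move: (\sum_(f in C) _) (\sum_(f in E :\: C) _).
  by clear; lia.
(* As [z] already hits [f], this edge is dropped; its weight and the freed mark at [z] pay for marks
   on the vertices of [f :\ z] and for the excess 1. *)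
- have [|||D2 h2 le2] := IH ((E :\: C) :\ f) (Y1 :\ z :|: f :\ z).
  + apply: leq_ltn_trans ltN; rewrite [leqRHS](sum_setD1 _ fN).
    exact: leq_addl.
  + exact: szR.
  + move=> S cS; rewrite subUset => /andP[/subsetP YS /subsetP fS].
    have cSK : edge_closed E (S :|: K).
      apply/edge_closedP => g gE v vg vSK; have [gC|gC] := boolP (g \in C).
        by apply: subset_trans (subsetUr _ _); move: gC; rewrite inE => /andP[].
      have [->|gf] := eqVneq g f.
        apply/subsetP => u uf; rewrite inE; have [->|uz] := eqVneq u z.
          by rewrite zK orbT.
        by rewrite fS // in_setD1 uz.
      have gR : g \in (E :\: C) :\ f by rewrite in_setD1 gf inE gC.
      apply: subset_trans (subsetUl _ _).
      apply: (edge_closedP _ _ cS g gR v) => //; move: vSK; rewrite inE.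
      by rewrite (negPf (coverR v (in_cover gR vg))) orbF.
    have /mY1/(_ _)/subsetP ESK := cSK.
    apply/subsetP => v vR.
    have := ESK _ v (subsetP (cover_subset (subset_trans (subsetDl _ _) (subsetDl _ _))) v vR).
    rewrite inE (negPf (coverR v vR)) orbF; apply.
    apply/subsetP => y yY; rewrite inE; have [->|yz] := eqVneq y z.
      by rewrite zK orbT.
    by rewrite YS // in_setD1 yz.
  exists (D1 :|: D2).
    move=> g gE; have [gC|gC] := boolP (g \in C).
      by have [v vg vD] := h1 g gC; exists v; rewrite // inE vD.
    have [->|gf] := eqVneq g f; first by exists z; rewrite // inE zD1.
    have [|v vg vD] := h2 g; first by rewrite in_setD1 gf inE gC.
    by exists v; rewrite // inE vD orbT.
  have : #|cover C| + #|cover ((E :\: C) :\ f)| <= #|cover E|.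
    rewrite -cardsUI (_ : _ :&: _ = set0) ?cards0 ?addn0.
      apply: subset_leq_card; rewrite subUset !cover_subset //.
      exact: subset_trans (subsetDl _ _) (subsetDl _ _).
    apply/setP => v; rewrite in_set0; apply/negP => /setIP[vC /coverR].
    by rewrite (subsetP coverC).
  have := (leq_card_setU D1 D2).1; have := mark_weight_ge (sz f fE).
  have := (leq_card_setU (Y1 :\ z) (f :\ z)).1.
  have := cardsD1 z Y1; have := cardsD1 z f; rewrite zY zf.
  move: le1 le2; rewrite /potential (sum_setD _ CE) (sum_setD1 _ fN).
  by clear; lia.
Qed.

Lemma sum_card_setI_components E (P : {set {set V}}) (A : {set V}) :
    {in P, forall K, exists z, K = component E z} ->
  \sum_(K in P) #|A :&: K| <= #|A|.
Proof.
move=> compP.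
have cAK K : K \in P -> #|A :&: K| = \sum_(v in A) (v \in K).
  move=> _; rewrite -sum1_card big_mkcond [RHS]big_mkcond.
  by apply: eq_bigr => v _; rewrite inE; case: (v \in A); case: (v \in K).
rewrite (eq_bigr _ cAK) exchange_big -sum1_card; apply: leq_sum => v _.
have [/exists_inP[K KP vK]|/exists_inPn noK] := boolP [exists K in P, v \in K].
  rewrite (sum_setD1 _ KP) vK big1 // => K' /setD1P[KK' K'P].
  have [z Kz] := compP K KP; have [z' Kz'] := compP K' K'P.
  apply/eqP; rewrite eqb0; apply: contraNN KK' => vK'.
  by rewrite Kz Kz' -(@component_eq E z v) -?Kz // -(@component_eq E z' v) -?Kz'.
by rewrite big1 // => K /noK/negPf->.
Qed.

Lemma marks_component E E' z : E' \subset E ->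
    (forall g, g \in E -> g \subset component E' z -> g \in E') ->
  marks [set g in E | g \subset component E' z] [set z].
Proof.
move=> sE hE S cS; rewrite sub1set => zS; set K := component E' z.
have cSK : edge_closed E' (S :&: K).
  apply/edge_closedP => g gE' v vg /setIP[vS vK].
  have gK : g \subset K.
    exact: (edge_closedP _ _ (component_closed E' z) g gE' v).
  rewrite subsetI gK andbT; apply: (edge_closedP _ _ cS g _ v) => //.
  by rewrite inE gK andbT (subsetP sE).
have /subsetP KS : K \subset S :&: K.
  by apply: component_min => //; rewrite inE zS component_refl.
apply/bigcupsP => g; rewrite inE => /andP[_ /subsetP gK].
by apply/subsetP => v /gK/KS/setIP[].
Qed.

(* Marking all neighbors of a deleted vertex is too expensive; one neighbor per
   component is enough, and by [mark_bound_cut] each component may be assumed to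
   meet the edges at [x] at least twice. *)
Lemma mark_bound_or_representatives E Y x : {in E, forall f, 1 < #|f|} ->
    mark_bound_below (\sum_(f in E) #|f|) -> marks E Y ->
    nbrs E x \subset cover (E :\: star E x) ->
  mark_bound E Y \/
  exists2 Z : {set V}, 2 * #|Z| <= \sum_(f in star E x) #|f|.-1 &
    forall S, edge_closed (E :\: star E x) S -> Z \subset S ->
      nbrs E x :&: cover (E :\: star E x) \subset S.
Proof.
set E' := E :\: _ => sz IH mY nE'; pose K z := component E' z.
have xK z : z \in nbrs E x -> x \notin K z.
  case/setD1P=> zx _; have : K z \subset ~: [set x].
    apply: component_min; last by rewrite !inE.
    apply/edge_closedP => g gE' v vg _; rewrite subsetC sub1set inE.
    by apply: contra (notin_cover_star E x) => xg; apply: in_cover xg.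
  by move/subsetP/(_ x); rewrite !inE eqxx; case: (x \in K z) => // /(_ isT).
(* A component met only once by the edges at [x], counted with multiplicity, hangs on a single edge
   [f] through [z] and can be cut off. *)
have [/exists_inP[z zN le1]|/exists_inPn ge2] := boolP
    [exists z in nbrs E x, \sum_(f in star E x) #|(f :\ x) :&: K z| <= 1].
  left; have /nbrsP[f fx zf] := zN.
  have zfK : z \in (f :\ x) :&: K z by rewrite inE zf component_refl.
  move: le1; rewrite (sum_setD1 _ fx).
  have : 0 < #|(f :\ x) :&: K z| by apply/card_gt0P; exists z.
  case c1: #|_ :&: _| => [//|[|//]] _; rewrite addnC addn1 ltnS leqn0 => /eqP c0.
  have fK : f :&: K z = [set z].
    have <- : (f :\ x) :&: K z = [set z].
      have /eqP/cards1P[u fu] := c1; have := zfK; rewrite fu inE => /eqP zu.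
      by rewrite [in RHS]zu.
    apply/setP => v; rewrite !inE.
    by have [->|vx] := eqVneq v x; rewrite //= (negPf (xK z zN)) !andbF.
  have [fE xf] : f \in E /\ x \in f by move: fx; rewrite inE => /andP[].
  apply: (mark_bound_cut sz IH mY fE fK).
  - move=> g /setD1P[gf gE]; have [xg|xg] := boolP (x \in g).
      apply/orP; right; rewrite -setI_eq0 -cards_eq0 eqn_leq leq0n andbT -c0.
      have gx : g \in star E x :\ f by rewrite !inE gf gE.
      rewrite (sum_setD1 _ gx); apply: leq_trans (leq_addr _ _).
      apply: subset_leq_card; apply/subsetP => v /setIP[vg vK].
      rewrite !inE vg vK !andbT; apply: contraNneq (xK z zN) => <-.
      by [].
    rewrite orbC; apply: (forall_inP (component_closed E' z)).
    by rewrite !inE gE (negPf xg).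
  - apply: marks_component; first exact: subsetDl.
    move=> g gE /subsetP gK; rewrite !inE gE andbT /=.
    by apply: contra (xK z zN) => /gK.
  - have /bigcupP[g gE' zg] := subsetP nE' z zN.
    apply: (in_cover _ zg); rewrite inE (subsetP (subsetDl _ _) g gE') /=.
    apply: (edge_closedP _ _ (component_closed E' z) g gE' z) => //.
    exact: component_refl.
right; pose P : {set {set V}} := [set K z | z in nbrs E x].
(* One neighbor of [x] in each component; the default [x] is never taken on [P], whose members are
   components of neighbors. *)
pose r L := odflt x [pick u in L :&: nbrs E x].
exists [set r L | L in P].
  apply: leq_trans (_ : 2 * #|P| <= _); first by rewrite leq_mul2l leq_imset_card.
  rewrite mulnC -sum_nat_const.
  apply: leq_trans (_ : \sum_(L in P) \sum_(f in star E x) #|(f :\ x) :&: L| <= _).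
    by apply: leq_sum => L /imsetP[z zN ->]; rewrite ltnNge ge2.
  rewrite exchange_big /=; apply: leq_sum => f; rewrite inE => /andP[_ xf].
  have -> : #|f|.-1 = #|f :\ x| by rewrite (cardsD1 x f) xf.
  apply: (@sum_card_setI_components E') => L /imsetP[z _ ->].
  by exists z.
move=> S cS /subsetP ZS; apply/subsetP => z /setIP[zN _].
have [u uK uZ] : exists2 u, u \in K z & u \in [set r L | L in P].
  exists (r (K z)); last by apply: imset_f; apply: imset_f.
  rewrite /r; case: pickP => [u /setIP[]//|/(_ z)].
  by rewrite inE zN component_refl.
have /subsetP := component_min cS (ZS u uZ); apply.
by rewrite (component_eq uK) component_refl.
Qed.

(** Deleting [x] and marking all its surviving neighbors succeeds if [x] lies in a second edge of
    size 2 or some neighbor becomes uncovered. If [x] has degree at least 3, marking one neighbor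
    per component succeeds. The second alternative is what remains. *)
Lemma mark_bound_vertex E Y x y : {in E, forall f, 1 < #|f| <= 3} ->
    mark_bound_below (\sum_(f in E) #|f|) -> marks E Y ->
    x != y -> [set x; y] \in E ->
  mark_bound E Y \/
  [/\ #|star E x| <= 2, nbrs E x \subset cover (E :\: star E x) &
      {in star E x, forall f, f != [set x; y] -> #|f| = 3}].
Proof.
move=> sz IH mY xy eE; set E' := E :\: star E x; set N := nbrs E x.
have sz1 : {in E, forall f, 1 < #|f|} by move=> f /sz/andP[].
have eS : [set x; y] \in star E x by rewrite !inE eE eqxx.
have ce : #|[set x; y]| = 2 by rewrite cards2 xy.
have xE : x \in cover E by apply: (in_cover eE); rewrite !inE eqxx.
pose A := \sum_(f in star E x) (#|f| == 2).
have sS f : f \in star E x -> 1 < #|f| <= 3 by rewrite inE => /andP[/sz].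
have wS : \sum_(f in star E x) mark_weight #|f| = 3 * #|star E x| + 2 * A.
  rewrite mulnC -sum_nat_const /A big_distrr -big_split /=.
  by apply: eq_bigr => f /sS; case: #|f| => [|[|[|[|]]]].
have dS : \sum_(f in star E x) #|f|.-1 + A = 2 * #|star E x|.
  rewrite mulnC -sum_nat_const /A -big_split /=.
  by apply: eq_bigr => f /sS; case: #|f| => [|[|[|[|]]]].
have s1 : 0 < #|star E x| by apply/card_gt0P; exists [set x; y].
have A1 : 0 < A by rewrite /A (sum_setD1 _ eS) ce eqxx.
have cN : #|N :&: cover E'| + #|N :\: cover E'| + A <= 2 * #|star E x|.
  by rewrite -dS leq_add2r cardsID card_nbrs.
(* With [s] edges at [x], the weights sum to [3 s + 2 A] and [x] has at most [2 s - A] neighbors; an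
   uncovered neighbor gains 3 and also saves a mark. *)
have delete : 8 <= 4 * #|N :\: cover E'| + #|star E x| + 3 * A -> mark_bound E Y.
  move=> le8; apply: (mark_bound_delete (Z := N :&: cover E')) IH mY xE _ _ => //.
  rewrite wS -/N -/E'; move: cN le8.
  by clear; lia.
have [/exists_inP[f fS /andP[fe f2]]|/exists_inPn no2] :=
  boolP [exists f in star E x, (f != [set x; y]) && (#|f| == 2)].
  left; apply: delete.
  have fS' : f \in star E x :\ [set x; y] by rewrite in_setD1 fe.
  have A2 : 1 < A.
    by rewrite /A (sum_setD1 _ eS) ce eqxx (sum_setD1 _ fS') f2.
  have : 1 < #|star E x|.
    by apply/card_gt1P; exists f, [set x; y].
  by move: A2; clear; lia.
have [nE'|nE'] := boolP (N \subset cover E'); last first.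
  left; apply: delete; have : 0 < #|N :\: cover E'|.
    by rewrite card_gt0 setD_eq0.
  by move: s1 A1; clear; lia.
have A1' : A = 1.
  rewrite /A (sum_setD1 _ eS) ce eqxx big1 // => f /setD1P[fe fS].
  by have := no2 f fS; rewrite fe /= => /negPf->.
have [s2|s3] := leqP #|star E x| 2.
  right; split=> // f fS fe; have := no2 f fS; rewrite fe /=.
  by move: (sS f fS); case: #|f| => [|[|[|[|]]]].
left; have [//|[Z leZ hZ]] := mark_bound_or_representatives sz1 IH mY nE'.
apply: (mark_bound_delete (Z := Z)) IH mY xE hZ _ => //.
rewrite wS A1'; move: dS leZ s3; rewrite A1'.
by move: (\sum_(f in star E x) _) #|star E x| => ? ?; clear; lia.
Qed.

(* Contract the three edges to [f :\ x :|: g :\ y]: a vertex hitting it lies in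
   [f], and then [y] hits the other two edges, or in [g], and then [x] does. *)
Lemma mark_bound_contract E Y x y f g : {in E, forall f, 1 < #|f|} ->
    mark_bound_below (\sum_(f in E) #|f|) -> marks E Y ->
    x != y -> [set x; y] \in E -> f != [set x; y] -> g != [set x; y] ->
    star E x = [set [set x; y]; f] -> star E y = [set [set x; y]; g] ->
    f != g -> #|f| = 3 -> #|g| = 3 ->
  mark_bound E Y.
Proof.
move=> sz IH mY xy eE fe ge sx sy fg f3 g3; set e := [set x; y].
have ce : #|e| = 2 by rewrite cards2 xy.
have /setIdP[fE xf] : f \in star E x by rewrite sx !inE eqxx orbT.
have /setIdP[gE yg] : g \in star E y by rewrite sy !inE eqxx orbT.
have inx d : d \in E -> x \in d -> (d == e) || (d == f).
  move=> dE xd; have : d \in star E x by rewrite inE dE.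
  by rewrite sx !inE.
have iny d : d \in E -> y \in d -> (d == e) || (d == g).
  move=> dE yd; have : d \in star E y by rewrite inE dE.
  by rewrite sy !inE.
have yf : y \notin f by apply/negP => /(iny f fE); rewrite (negPf fe) (negPf fg).
have xg : x \notin g.
  by apply/negP => /(inx g gE); rewrite (negPf ge) eq_sym (negPf fg).
set h := f :\ x :|: g :\ y.
have cfx : #|f :\ x| = 2 by have := cardsD1 x f; rewrite xf f3 => -[].
have cgy : #|g :\ y| = 2 by have := cardsD1 y g; rewrite yg g3 => -[].
have h2 : 1 < #|h| by rewrite -cfx subset_leq_card ?subsetUl.
have h4 : #|h| <= 4 by have := (leq_card_setU (f :\ x) (g :\ y)).1; rewrite cfx cgy.
have xh : x \notin h by rewrite !inE eqxx (negPf xg) andbF.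
have yh : y \notin h by rewrite !inE eqxx (negPf yf) andbF.
pose R := E :\ e :\ f :\ g.
have fE1 : f \in E :\ e by rewrite in_setD1 fe.
have gE1 : g \in E :\ e :\ f by rewrite !in_setD1 eq_sym fg ge.
have sumE w : \sum_(d in E) w d = w e + (w f + (w g + \sum_(d in R) w d)).
  by rewrite (sum_setD1 _ eE) (sum_setD1 _ fE1) (sum_setD1 _ gE1).
have RP d : reflect [/\ d \in E, x \notin d & y \notin d] (d \in R).
  apply: (iffP idP).
    rewrite !in_setD1 => /and4P[dg df de dE]; split=> //.
      by apply/negP => /(inx d dE); rewrite (negPf de) (negPf df).
    by apply/negP => /(iny d dE); rewrite (negPf de) (negPf dg).
  case=> dE xd yd; rewrite !in_setD1 dE.
  apply/and4P; split=> //.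
  - by apply: contraNneq yd => ->.
  - by apply: contraNneq xd => ->.
  - by apply: contraNneq xd => ->; rewrite !inE eqxx.
have /card_gt0P[z zfx] : 0 < #|f :\ x| by rewrite cfx.
have /setD1P[zx zf] := zfx.
have zh : z \in h by rewrite inE zfx.
(* A mark inside [h] puts all of [h] into every closed set that contains the marks. *)
have [Y1 [zY mY1 leY]] := marks_rebase mY (in_cover fE zf).
apply: mark_bound_le leY _.
have [|||D hD leD] := IH (h |: R) Y1.
- apply: leq_ltn_trans (sum_setU1_le _ _ _) _; rewrite sumE.
  rewrite ce f3 g3 !addnA ltn_add2r; exact: leq_ltn_trans h4 _.
- move=> d /setU1P[->//|/RP[dE _ _]]; exact: sz.
- move=> S cS YS; have zS := subsetP YS z zY.
  have /subsetP hS : h \subset S.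
    by apply: (edge_closedP _ _ cS h _ z); rewrite ?setU11.
  have cSe : edge_closed E (S :|: e).
    apply/edge_closedP => d dE v vd vS; apply/subsetP => u ud; rewrite in_setU.
    have [dx|dx] := boolP (x \in d).
      case/orP: (inx d dE dx) => /eqP dd; rewrite dd in ud; first by rewrite ud orbT.
      have [->|ux] := eqVneq u x; first by rewrite set21 orbT.
      by rewrite hS // in_setU in_setD1 ux ud.
    have [dy|dy] := boolP (y \in d).
      case/orP: (iny d dE dy) => /eqP dd; rewrite dd in ud; first by rewrite ud orbT.
      have [->|uy] := eqVneq u y; first by rewrite set22 orbT.
      by rewrite hS // in_setU !in_setD1 uy ud orbT.
    have dR : d \in h |: R by apply/setU1P; right; apply/RP.
    apply/orP; left; apply: (subsetP (edge_closedP _ _ cS d dR v vd _)) ud.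
    case/setUP: vS => // /set2P[] vv; first by rewrite -vv vd in dx.
    by rewrite -vv vd in dy.
  have ESe := mY1 _ cSe (subset_trans YS (subsetUl _ _)).
  apply/bigcupsP => d /setU1P[->|/RP[dE dx dy]]; first exact/subsetP.
  apply/subsetP => v vd; case/setUP: (subsetP ESe v (in_cover dE vd)) => //.
  by case/set2P=> vv; rewrite -vv vd in dx dy.
have leC : #|cover (h |: R)| + 2 <= #|cover E|.
  rewrite -ce; have -> : #|cover (h |: R)| + #|e| = #|cover (h |: R) :|: e|.
    rewrite cardsU (_ : _ :&: _ = set0) ?cards0 ?subn0 //.
    apply/setP => v; rewrite in_set0; apply/negP => /setIP[].
    case/bigcupP=> d dR vd /set2P vv; case/setU1P: dR vd => [->|/RP[dE dx dy]] vd.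
      by case: vv => vv; [move: xh|move: yh]; rewrite -vv vd.
    by case: vv => vv; [move: dx|move: dy]; rewrite -vv vd.
  apply: subset_leq_card; rewrite subUset (sub_cover eE) andbT.
  apply/bigcupsP => d /setU1P[->|/RP[dE _ _]]; last exact: sub_cover.
  by rewrite subUset !(subset_trans (subsetDl _ _) (sub_cover _)).
(* The three removed edges weigh 5 + 3 + 3 and the two lost vertices 3 each; [h] weighs at most 5,
   and 17 - 5 = 12 pays for one vertex. *)
have leP : potential (h |: R) + 12 <= potential E.
  rewrite /potential sumE ce f3 g3.
  have := sum_setU1_le R h (fun d => mark_weight #|d|); move: leC.
  have : mark_weight #|h| <= 5 by move: h2 h4; case: #|h| => [|[|[|[|[|]]]]].
  rewrite (_ : mark_weight 2 = 5) // (_ : mark_weight 3 = 3) //.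
  by move: (\sum_(d in h |: R) _) (\sum_(d in R) _) (mark_weight #|h|); clear; lia.
have [v vh vD] : exists2 v, v \in h & v \in D by apply: hD; rewrite setU11.
have [u uxy hu] : exists2 u, u \in e & hitting E (u |: D).
  have hR u d : d \in R -> exists2 v, v \in d & v \in u |: D.
    move=> dR; have [|w wd wD] := hD d; first by rewrite in_setU dR orbT.
    by exists w; rewrite // in_setU wD orbT.
  case/setUP: vh => /setD1P[_ vfg]; [exists y|exists x]; rewrite ?inE ?eqxx ?orbT //.
    move=> d dE; have [yd|yd] := boolP (y \in d); first by exists y; rewrite // setU11.
    have [xd|xd] := boolP (x \in d); last by apply: hR; apply/RP.
    case/orP: (inx d dE xd) => /eqP dd; first by rewrite dd !inE eqxx orbT in yd.
    by exists v; rewrite ?dd // in_setU vD orbT.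
  move=> d dE; have [xd|xd] := boolP (x \in d); first by exists x; rewrite // setU11.
  have [yd|yd] := boolP (y \in d); last by apply: hR; apply/RP.
  case/orP: (iny d dE yd) => /eqP dd; first by rewrite dd !inE eqxx in xd.
  by exists v; rewrite ?dd // in_setU vD orbT.
exists (u |: D) => //; have := (leq_card_setU [set u] D).1; rewrite cards1.
by move: leD leP; clear; lia.
Qed.

(** Removing [y] from a large edge lowers its weight by 2. This may split a component; marking both
    [y] and another vertex [z] of [f] repairs that with at most one extra mark. *)
Lemma mark_bound_shrink E Y f : {in E, forall f, 1 < #|f|} ->
    mark_bound_below (\sum_(f in E) #|f|) -> marks E Y ->
    f \in E -> 3 < #|f| ->
  mark_bound E Y.
Proof.
move=> sz IH mY fE f4.
have /card_gt1P[y [z [yf zf yz]]] : 1 < #|f| by apply: sz.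
have cf : #|f :\ y| = #|f|.-1 by rewrite (cardsD1 y f) yf.
have [Y1 [yY mY1 leY]] := marks_rebase mY (in_cover fE yf).
apply: mark_bound_le leY _.
have subcover : cover (f :\ y |: E :\ f) \subset cover E.
  apply/bigcupsP => d /setU1P[->|/setD1P[_ /sub_cover//]].
  by apply: subset_trans (subsetDl _ _) (sub_cover fE).
have [|||D hD leD] := IH (f :\ y |: E :\ f) (z |: Y1).
- apply: leq_ltn_trans (sum_setU1_le _ _ _) _; rewrite [ltnRHS](sum_setD1 _ fE) cf.
  by rewrite ltn_add2r prednK // ltnW // sz.
- move=> d /setU1P[->|/setD1P[_ /sz]//]; rewrite cf.
  by move: f4; case: #|f| => [|[|[|]]].
- move=> S cS; rewrite subUset sub1set => /andP[zS YS].
  apply: subset_trans subcover _; apply: mY1 => //; apply/edge_closedP => d dE v vd vS.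
  have [->|df] := eqVneq d f; last first.
    by apply: (edge_closedP _ _ cS d _ v); rewrite // in_setU in_setD1 df dE orbT.
  rewrite -(setD1K yf) subUset sub1set (subsetP YS) //=.
  apply: (edge_closedP _ _ cS _ _ z); rewrite ?setU11 //.
  by rewrite in_setD1 eq_sym yz.
exists D.
  move=> d dE; have [->|df] := eqVneq d f.
    have [|v /setD1P[_ vf] vD] := hD (f :\ y); first by rewrite setU11.
    by exists v.
  by apply: hD; rewrite in_setU in_setD1 df dE orbT.
have : potential (f :\ y |: E :\ f) + 2 <= potential E.
  rewrite /potential [X in _ <= _ + X](sum_setD1 _ fE).
  have := sum_setU1_le (E :\ f) (f :\ y) (fun d => mark_weight #|d|).
  have : mark_weight #|f :\ y| + 2 <= mark_weight #|f|.
    rewrite cf /mark_weight; move: f4; case: #|f| => [|[|[|[|]]]] //= n _.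
    by clear; lia.
  have := subset_leq_card subcover.
  move: (\sum_(d in _ |: _) _) (\sum_(d in _ :\ _) _) (mark_weight _) (mark_weight _).
  by clear; lia.
have := (leq_card_setU [set z] Y1).1; rewrite cards1.
by move: leD; clear; lia.
Qed.

Theorem hitting_marks E Y : {in E, forall f, 1 < #|f|} -> marks E Y ->
  mark_bound E Y.
Proof.
have [n] := ubnP (\sum_(f in E) #|f|); elim: n E Y => // n IHn E Y ltn sz mY.
have IH : mark_bound_below (\sum_(f in E) #|f|).
  by move=> E' Y' lt; apply: IHn; apply: leq_trans lt _.
have [/exists_inP[f fE f4]|/exists_inPn no4] := boolP [exists f in E, 3 < #|f|].
  exact: mark_bound_shrink fE f4.
have sz3 : {in E, forall f, 1 < #|f| <= 3}.
  by move=> f fE; rewrite sz //= leqNgt no4.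
have [/exists_inP[e eE /cards2P[x [y [xy exy]]]]|/exists_inPn no2] :=
  boolP [exists f in E, #|f| == 2]; last first.
  (* When all edges have size 3, the potential is exactly three times the right-hand side of
     [hitting_cm]. *)
  have [D hD leD] := hitting_cm sz; exists D => //.
  have w3 f : f \in E -> mark_weight #|f| = 3 * cm_weight #|f|.
    move=> fE; have := no2 f fE; have := sz3 f fE.
    by case: #|f| => [|[|[|[|]]]].
  have sumw : \sum_(f in E) mark_weight #|f| = 3 * \sum_(f in E) cm_weight #|f|.
    by rewrite big_distrr; apply: eq_bigr.
  apply: leq_trans (leq_addr _ _); rewrite /potential sumw -mulnDr.
  by rewrite -[12]/(3 * 4) -mulnA leq_mul2l.
rewrite exy in eE.
have [//|[sx nx x3]] := mark_bound_vertex sz3 IH mY xy eE.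
have eE' : [set y; x] \in E by rewrite setUC.
have yx : y != x by rewrite eq_sym.
have [//|[sy ny y3]] := mark_bound_vertex sz3 IH mY yx eE'.
have xe : x \in [set x; y] by rewrite !inE eqxx.
have ye : y \in [set x; y] by rewrite !inE eqxx orbT.
(* As [u] stays covered when the edges at [v] are removed, it lies in an edge avoiding [v]; having
   degree at most 2, it has no further edge. *)
have other u v : #|star E u| <= 2 -> nbrs E v \subset cover (E :\: star E v) ->
    u != v -> [set x; y] \in star E u -> [set x; y] \in star E v ->
    exists2 f, f != [set x; y] & v \notin f /\ star E u = [set [set x; y]; f].
  move=> su nv uv eu ev.
  have /bigcupP[f] : u \in cover (E :\: star E v).
    apply: (subsetP nv); apply/nbrsP; exists [set x; y] => //.
    by rewrite in_setD1 uv; move: eu; rewrite inE => /andP[].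
  rewrite inE => /andP[fv fE] uf.
  have fe : f != [set x; y] by apply: contraNneq fv => ->.
  have vf : v \notin f by apply: contra fv => vf; rewrite inE fE.
  exists f => //; split=> //; apply: star_eq2 => //; first by rewrite eq_sym.
    by move: eu; rewrite inE => /andP[].
  apply/eqP; rewrite eqn_leq su /=; apply/card_gt1P; exists f, [set x; y].
  by rewrite inE fE uf.
have eSx : [set x; y] \in star E x by rewrite inE eE xe.
have eSy : [set x; y] \in star E y by rewrite inE eE ye.
have [f fe [yf sxf]] := other x y sx ny xy eSx eSy.
have [g ge [xg syg]] := other y x sy nx yx eSy eSx.
have fS : f \in star E x by rewrite sxf !inE eqxx orbT.
have gS : g \in star E y by rewrite syg !inE eqxx orbT.
apply: (mark_bound_contract sz IH mY xy eE fe ge sxf syg).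
- by apply: contraNneq xg => <-; move: fS; rewrite inE => /andP[].
- exact: x3.
- by apply: y3; rewrite // setUC.
Qed.

End Marks.

(** * Level functions *)

Lemma set2_eq (T : finType) (a b c d : T) : [set a; b] = [set c; d] ->
  (a = c /\ b = d) \/ (a = d /\ b = c).
Proof.
move=> eqs; have ha : a \in [set c; d] by rewrite -eqs set21.
have hb : b \in [set c; d] by rewrite -eqs set22.
have hc : c \in [set a; b] by rewrite eqs set21.
have hd : d \in [set a; b] by rewrite eqs set22.
case/set2P: ha => ac; [left | right]; split=> //.
  by case/set2P: hb => // bc; case/set2P: hd => dd; rewrite dd // ac.
by case/set2P: hb => // bd; case/set2P: hc => cc; rewrite cc // ac.
Qed.

Section Levels.

Variables (T : finType) (e : rel T).
Implicit Types (r u v w : T) (d : T -> nat).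

Definition level_function r d : Prop :=
  d r = 0 /\ forall v, v != r -> exists2 u, e v u & d v = (d u).+1.

Definition bottom d v : bool := [forall u, e v u ==> (d u != (d v).+1)].

Lemma distance_level_function r : symmetric e -> connected_graph e ->
  exists d, level_function r d.
Proof.
move=> sym_e conn.
pose P v n := [exists p : n.-tuple T, path e r p && (last r p == v)].
have PI v p : path e r p -> last r p = v -> P v (size p).
  by move=> pp lp; apply/existsP; exists (in_tuple p); rewrite pp lp eqxx.
have exP v : exists n, P v n.
  by have /connectP[p pp lp] := conn r v; exists (size p); apply: PI.
pose d v := ex_minn (exP v).
have dP v n : P v n -> d v <= n by rewrite /d; case: ex_minnP => m _; apply.
exists d; split; first by apply/eqP; rewrite -leqn0; apply: dP; apply: (PI r [::]).
move=> v vr; have /existsP[p /andP[]] : P v (d v) by rewrite /d; case: ex_minnP.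
have : size p = d v by rewrite size_tuple.
case/lastP: {p}(tval p) => [_ _ /eqP /= rv|p w]; first by rewrite -rv eqxx in vr.
rewrite size_rcons rcons_path last_rcons => sp /andP[pp ew] /eqP wv.
exists (last r p); first by rewrite sym_e -wv.
apply/eqP; rewrite eqn_leq -[in _.+1 <= _]sp ltnS (dP _ _ (PI _ p pp erefl)) andbT.
have /existsP[q /andP[pq /eqP lq]] : P (last r p) (d (last r p)).
  by rewrite /d; case: ex_minnP.
have -> : (d (last r p)).+1 = size (rcons q v) by rewrite size_rcons size_tuple.
by apply/dP/PI; rewrite ?last_rcons // rcons_path pq lq -wv.
Qed.

Lemma level_surjective r d v k : level_function r d -> k <= d v ->
  exists u, d u = k.
Proof.
move=> [dr dS]; have [n] := ubnP (d v); elim: n v => // n IHn v ltn kv.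
have [->|ne] := eqVneq k (d v); first by exists v.
have lt : k < d v by rewrite ltn_neqAle ne.
have vr : v != r by apply: contraTneq lt => ->; rewrite dr.
have [u _ du] := dS v vr; rewrite du in lt ltn; exact: (IHn u).
Qed.

(** All levels from 0 to [d v] occur. This bounds the sum of the levels, so that it can be
    maximized. *)
Lemma level_lt r d v : level_function r d -> d v < #|T|.
Proof.
move=> ld; rewrite -[(d v).+1](size_iota 0) cardE -(size_map d).
apply: uniq_leq_size (iota_uniq _ _) _ => k; rewrite mem_iota /= add0n ltnS => kv.
by have [u <-] := level_surjective ld kv; apply: map_f; rewrite mem_enum.
Qed.

Lemma exists_level_function r : symmetric e -> irreflexive e -> connected_graph e ->
  exists2 d, level_function r d &
    forall u v, u != r -> v != r -> bottom d u -> bottom d v -> ~~ e u v.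
Proof.
move=> sym_e irr_e conn; have [d0 ld0] := distance_level_function r sym_e conn.
have le_sum d : level_function r d -> \sum_v d v <= #|T| * #|T|.
  move=> ld; rewrite -sum_nat_const; apply: leq_sum => v _.
  exact: ltnW (level_lt v ld).
have [n] := ubnP (#|T| * #|T| - \sum_v d0 v).
elim: n d0 ld0 => // n IHn d ld ltn.
have [/existsP[u /existsP[v]]|noadj] := boolP [exists u, [exists v,
    [&& u != r, v != r, bottom d u, bottom d v, e u v & d v <= d u]]].
  case/and5P=> ur vr bu bv /andP[uv vu]; have [dr dS] := ld.
  have uv' : u != v.
    by apply: contraTneq uv => ->; rewrite irr_e.
  (* Raising [v] above [u] is legal: [v] is a bottom vertex, so no vertex relies on it as its
     neighbor one level below. The sum grows because [d v <= d u]. *)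
  pose d' w := if w == v then (d u).+1 else d w.
  have ld' : level_function r d'.
    split; first by rewrite /d' eq_sym (negPf vr).
    move=> w wr; rewrite /d'; have [->|wv] := eqVneq w v.
      by exists u; rewrite ?(negPf uv') // sym_e.
    have [x wx dw] := dS w wr; exists x => //; case: eqVneq => [xv|//].
    have /forallP/(_ w) := bv; rewrite -xv sym_e wx /= -dw.
    by rewrite eqxx.
  apply: (IHn d' ld'); have := le_sum _ ld'.
  have : \sum_w d w < \sum_w d' w.
    rewrite (bigD1 v) // [ltnRHS](bigD1 v) //= {1}/d' eqxx.
    rewrite -addSn leq_add // leq_sum // => w wv.
    by rewrite /d' (negPf wv).
  by move: ltn; clear; lia.
exists d => // u v ur vr bu bv; apply: contra noadj => uv.
have [vu|uv'] := leqP (d v) (d u).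
  by apply/existsP; exists u; apply/existsP; exists v; rewrite ur vr bu bv uv.
apply/existsP; exists v; apply/existsP; exists u.
by rewrite ur vr bu bv sym_e uv ltnW.
Qed.

End Levels.

(** * Total domination from a level function *)

Section TotalDomination.

Variables (T : finType) (e : rel T).
Implicit Types (r u v w : T) (d : T -> nat).

(** The edges from each nonroot [v] to [p v], one level below, are distinct. A bottom vertex [v] has
    a second neighbor [q v]; the edge between them belongs to no other vertex of [B], these being
    nonadjacent, and is not a tree edge, as [q v] is not one level above [v]. *)
Lemma bottom_count r d : symmetric e -> irreflexive e ->
    (forall v, 2 <= degree e v) -> level_function e r d ->
    (forall u v, u != r -> v != r -> bottom e d u -> bottom e d v -> ~~ e u v) ->
  #|[set v | (v != r) && bottom e d v]| + #|T|.-1 <= graph_size e.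
Proof.
move=> sym_e irr_e deg2 [dr dS] nadj; set B := [set v | _].
pose p v := odflt r [pick u | e v u && (d v == (d u).+1)].
have pP v : v != r -> e v (p v) /\ d v = (d (p v)).+1.
  move=> vr; rewrite /p; case: pickP => [u /andP[vu /eqP du]|no] //.
  by have [u vu du] := dS v vr; have := no u; rewrite vu du eqxx.
pose q v := odflt r [pick u | e v u && (u != p v)].
have qP v : e v (q v) /\ q v != p v.
  rewrite /q; case: pickP => [u /andP[]|no] //.
  have /card_gt1P[a [b []]] := deg2 v; rewrite !inE => va vb.
  have := no a; have := no b; rewrite va vb /= => /negbFE/eqP-> /negbFE/eqP->.
  by rewrite eqxx.
have edge v u : e v u -> [set v; u] \in edge_set e.
  by move=> vu; rewrite inE; apply/existsP; exists v; apply/existsP; exists u; rewrite vu eqxx.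
have tree_inj : {in [set~ r] &, injective (fun v => [set v; p v])}.
  move=> v u; rewrite !inE => /pP[_ dv] /pP[_ du] /set2_eq[[]//|[vpu pvu]].
  by move: dv du; rewrite -vpu pvu; clear; lia.
have back_inj : {in B &, injective (fun v => [set v; q v])}.
  move=> v u; rewrite !inE => /andP[vr bv] /andP[ur bu] /set2_eq[[]//|[_ qvu]].
  by have := nadj v u vr ur bv bu; rewrite -qvu; have [->] := qP v.
pose tree := [set [set v; p v] | v in [set~ r]].
pose back := [set [set v; q v] | v in B].
have dis : tree :&: back = set0.
  apply/setP => A; rewrite in_set0; apply/negP => /setIP[/imsetP[u ur ->]].
  case/imsetP=> v; rewrite !inE in ur * => /andP[vr bv].
  have [upu du] := pP u ur; have [_ qv] := qP v.
  case/set2_eq=> -[uv puv]; first by rewrite -puv uv eqxx in qv.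
  have /forallP/(_ u) := bv; rewrite -puv du eqxx.
  by rewrite sym_e upu.
have <- : #|tree :|: back| = #|B| + #|T|.-1.
  rewrite cardsU dis cards0 subn0 !card_in_imset // addnC.
  by rewrite -(cardsC1 r).
apply: subset_leq_card; rewrite subUset; apply/andP; split; apply/subsetP => A.
  by case/imsetP=> v vr ->; apply: edge; move: vr; rewrite !inE => /pP[].
by case/imsetP=> v _ ->; apply: edge; have [] := qP v.
Qed.

Lemma total_domination_size : symmetric e -> irreflexive e ->
    connected_graph e -> 1 < #|T| -> (forall v, 2 <= degree e v) ->
  exists2 D : {set T}, total_dominating e D & 2 * #|D| <= graph_size e + 2.
Proof.
move=> sym_e irr_e conn T1 deg2.
have /card_gt0P[r _] : 0 < #|T| := ltnW T1.
have [d ld nadj] := exists_level_function r sym_e irr_e conn.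
have := bottom_count sym_e irr_e deg2 ld nadj; set B := [set v | _] => leB.
have [dr dS] := ld.
pose p v := odflt r [pick u | e v u && (d v == (d u).+1)].
have pP v : v != r -> e v (p v) /\ d v = (d (p v)).+1.
  move=> vr; rewrite /p; case: pickP => [u /andP[vu /eqP du]|no] //.
  by have [u vu du] := dS v vr; have := no u; rewrite vu du eqxx.
have [u1 ru1 du1] : exists2 u, e r u & d u = 1.
  have /card_gt1P[a [b [_ _ ab]]] := T1.
  have [v vr] : exists v, v != r.
    by have [ar|] := eqVneq a r; [exists b; rewrite -ar eq_sym|exists a].
  have [|u du] := level_surjective (k := 1) ld (v := v).
    by have [_ ->] := pP v vr.
  have ur : u != r by apply: contraTneq isT => ur; rewrite ur dr in du.
  have [upu] := pP u ur; rewrite du => -[dp]; exists u => //.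
  suff -> : r = p u by rewrite sym_e.
  apply/esym/eqP; apply: contraT => pr; have [_] := pP _ pr.
  by rewrite -dp.
(* [A] consists of the levels 2 and 3 mod 4. For a vertex [v] of [B], its neighbor [p v] is added to
   whichever of [A] and [~: A] lacks it. The vertex [u1] of level 1 dominates the root; it has to be
   added to [D1] but lies in [~: A]. *)
pose A := [set v | odd (d v)./2]; pose X := [set v | p v \in A].
pose D1 := A :|: p @: (B :\: X) :|: [set u1].
pose D2 := ~: A :|: p @: (B :&: X).
(* The neighbors one level below and one level above are two levels apart, so exactly one of them
   lies in [A]. *)
have middle v : v != r -> v \notin B -> exists2 c, e v c & (c \in A) = (p v \notin A).
  move=> vr; rewrite inE vr /= negb_forall => /existsP[c].
  rewrite negb_imply negbK => /andP[vc /eqP dc]; exists c => //.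
  by have [_ dv] := pP v vr; rewrite !inE dc dv.
have dom1 : total_dominating e D1.
  apply/forallP => v; apply/exists_inP; have [->|vr] := eqVneq v r.
    by exists u1; rewrite // !inE eqxx orbT.
  have [vp _] := pP v vr; have [pA|pA] := boolP (p v \in A).
    by exists (p v); rewrite // !in_setU pA.
  have [vB|vB] := boolP (v \in B).
    exists (p v) => //; rewrite !in_setU (imset_f p) ?orbT //.
    by rewrite in_setD vB andbT inE.
  have [c vc cA] := middle v vr vB; exists c => //.
  by rewrite !in_setU cA pA.
have dom2 : total_dominating e D2.
  apply/forallP => v; apply/exists_inP; have [->|vr] := eqVneq v r.
    by exists u1; rewrite // !inE du1.
  have [vp _] := pP v vr; have [pA|pA] := boolP (p v \in A); last first.
    by exists (p v); rewrite // in_setU in_setC pA.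
  have [vB|vB] := boolP (v \in B).
    exists (p v) => //; rewrite in_setU (imset_f p) ?orbT //.
    by rewrite in_setI vB inE.
  have [c vc cA] := middle v vr vB; exists c => //.
  by rewrite in_setU in_setC cA pA.
have leD : #|D1| + #|D2| <= #|T| + #|B| + 1.
  have l1 := (leq_card_setU (A :|: p @: (B :\: X)) [set u1]).1.
  have l2 := (leq_card_setU A (p @: (B :\: X))).1.
  have l3 := (leq_card_setU (~: A) (p @: (B :&: X))).1.
  have l4 := leq_imset_card p (B :\: X); have l5 := leq_imset_card p (B :&: X).
  have l6 := cardsID X B; have l7 := cardsC A.
  rewrite cards1 in l1; rewrite /D1 /D2.
  by move: l1 l2 l3 l4 l5 l6 l7; clear; lia.
have [le12|lt21] := leqP #|D1| #|D2|; [exists D1 | exists D2] => //.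
  by move: leB leD le12 T1; clear; lia.
by move: leB leD lt21 T1; clear; lia.
Qed.

End TotalDomination.

(** * Neighborhood hypergraphs and degree sequences *)

Lemma bigmin_le (I : finType) (P : pred I) (F : I -> nat) n i : P i ->
  \big[minn/n]_(j | P j) F j <= F i.
Proof.
move=> Pi; rewrite unlock; elim: (index_enum I) (mem_index_enum i) => //= j s IHs.
rewrite inE => /orP[/eqP <-|/IHs le]; first by rewrite Pi geq_minl.
by case: ifP => // _; rewrite geq_min le orbT.
Qed.

Section Graph.

Variables (T : finType) (e : rel T).
Implicit Types (x y : T).

Lemma min_degree_le x : min_degree e <= degree e x.
Proof. exact: bigmin_le. Qed.

Lemma total_domination_number_le (D : {set T}) : total_dominating e D ->
  total_domination_number e <= #|D|.
Proof. exact: (@bigmin_le _ (total_dominating e)). Qed.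

Lemma sum_degree : symmetric e -> irreflexive e ->
  \sum_x degree e x = 2 * graph_size e.
Proof.
move=> sym_e irr_e.
have degE x : degree e x = \sum_(A in edge_set e) (x \in A).
  have inj : {in [set y | e x y] &, injective (fun y => [set x; y])}.
    by move=> y z _ _ /set2_eq[[]|[-> ->]].
  rewrite /degree -(card_in_imset inj) -sum1_card big_mkcond [RHS]big_mkcond.
  apply: eq_bigr => A _; have [/imsetP[y]|] := boolP (A \in imset _ _).
    rewrite inE => xy ->; rewrite set21 inE; case: existsP => // -[].
    by exists x; apply/existsP; exists y; rewrite xy eqxx.
  case: ifP => // /[1!inE]/existsP[y /existsP[z /andP[yz /eqP->]]] no.
  apply/esym/eqP; rewrite eqb0; apply: contra no => /set2P[->|->].
    by apply/imsetP; exists z; rewrite ?inE.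
  by apply/imsetP; exists y; rewrite ?inE ?(sym_e z) // setUC.
rewrite (eq_bigr _ (fun x _ => degE x)) exchange_big mulnC -sum_nat_const.
apply: eq_bigr => A; rewrite inE => /existsP[y /existsP[z /andP[yz /eqP->]]].
have <- : #|[set y; z]| = 2.
  by rewrite cards2; case: eqP yz => // ->; rewrite irr_e.
by rewrite -sum1_card [RHS]big_mkcond; apply: eq_bigr => x _; case: (_ \in _).
Qed.

Definition neighborhood x : {set T} := [set y | e x y].

Definition neighborhoods : {set {set T}} := [set neighborhood x | x : T].

Lemma neighborhoodsP (f : {set T}) :
  reflect (exists x, f = neighborhood x) (f \in neighborhoods).
Proof.
apply: (iffP imsetP) => [[x _ ->]|[x ->]]; first by exists x.
by exists x.
Qed.

Lemma hitting_neighborhoods (D : {set T}) : hitting neighborhoods D ->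
  total_dominating e D.
Proof.
move=> hD; apply/forallP => x; apply/exists_inP.
have [|y] := hD (neighborhood x); first by apply/neighborhoodsP; exists x.
by rewrite inE; exists y.
Qed.

(** Not an equality, since vertices with equal neighborhoods yield a single edge. *)
Lemma sum_neighborhoods (w : nat -> nat) :
  \sum_(f in neighborhoods) w #|f| <= \sum_x w (degree e x).
Proof.
rewrite [leqRHS](partition_big_imset neighborhood) /=.
apply: leq_sum => f /imsetP[x _ ->].
by rewrite (bigD1 x) ?eqxx //= leq_addr.
Qed.

(** A closed set contains every neighborhood that it meets, so along a walk from [u] each vertex
    lies in [S] together with its neighborhood. Two marks are taken because the classes of a
    bipartite graph lie in different components. *)
Lemma marks_neighborhoods u v : connected_graph e -> symmetric e -> e u v ->
  marks neighborhoods [set u; v].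
Proof.
move=> conn sym_e uv S cS; rewrite subUset !sub1set => /andP[uS vS].
have step x y : e x y -> y \in S -> neighborhood x \subset S.
  move=> xy yS; apply: (edge_closedP _ _ cS _ _ y) => //.
    by apply/neighborhoodsP; exists x.
  by rewrite inE.
suff allS x : x \in S by apply/subsetP => x _; apply: allS.
have /connectP[p pp ->] := conn u x.
suff : forall w, w \in S -> neighborhood w \subset S -> path e w p -> last w p \in S.
  by apply => //; apply: step vS.
elim: p {pp} => [|y p IHp] w //= wS nS /andP[wy yp].
apply: IHp yp; first by apply: (subsetP nS); rewrite inE.
by apply: step wS; rewrite sym_e.
Qed.

Lemma big_degree_seq (F : nat -> nat) :
  \sum_(k <- degree_seq e) F k = \sum_x F (degree e x).
Proof.
by rewrite (perm_big _ (permEl (perm_sort _ _))) big_map big_enum.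
Qed.

Lemma sum_nth_take (s : seq nat) k : k <= size s ->
  \sum_(i < k) nth 0 s i = sumn (take k s).
Proof.
move=> ks; rewrite sumnE (big_nth 0) size_takel // big_mkord.
by apply: eq_bigr => i _; rewrite nth_take.
Qed.

End Graph.

(** * Degree sums below and above the cutoff *)

Lemma sumn_le_cutoff (c : nat) (s : seq nat) : 2 < c ->
  all (fun k => 1 < k <= c) s ->
  sumn s + (c - 2) * count (pred1 2) s <= c * size s.
Proof.
move=> c3; elim: s => [|k s IHs] /=; first by rewrite !muln0.
case/andP=> /andP[k2 kc] /IHs; rewrite mulnDr mulnS.
by case: eqP => [->|_] /=; rewrite ?muln1 ?muln0; move: c3 kc; clear; lia.
Qed.

Lemma sumn_ge_cutoff (c : nat) (s : seq nat) :
  all (leq c) s -> c * size s <= sumn s.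
Proof.
elim: s => [|k s IHs] /=; first by rewrite muln0.
by case/andP=> ck /IHs; rewrite mulnS; move: ck; clear; lia.
Qed.

(** [P] is the sum of the [A] smallest degrees and [U] counts the others. If [A <= g], then
    [2 A <= 2 U + n2]; multiplying by [c] and using [c U < P <= c A - (c - 2) n2] gives
    [(c - 4) n2 < 0]. *)
Lemma cutoff_contradiction c A U n2 m P g :
  3 < c -> P + (c - 2) * n2 <= c * A -> c * U <= 2 * m - P -> m < P ->
  4 * g <= 2 * (A + U) + n2 -> g < A.
Proof.
move=> c4 leP leU mP le_g; rewrite ltnNge; apply/negP => Ag.
have le1 : c * (2 * A) <= c * (2 * U + n2).
  by rewrite leq_mul2l; move: le_g Ag; clear; lia.
have le2 : 4 * n2 <= c * n2 by rewrite leq_mul2r c4 orbT.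
have le3 : 2 * n2 <= c * n2 by apply: leq_trans le2; rewrite leq_mul2r orbT.
rewrite mulnBl in leP; rewrite mulnDr !(mulnCA c) in le1.
move: (c * A) (c * U) (c * n2) leP leU mP le1 le2 le3 => x y z.
by clear; lia.
Qed.

Theorem theorem4 (T : finType) (e : rel T)
    (simple_e : simple_graph e)
    (nontrivial_e : 2 <= graph_order e)
    (connected_e : connected_graph e)
    (min_degree_e : min_degree e = 2) :
  total_domination_number e <= annihilation_number e + 1 /\
  (3 <= cutoff_degree e -> total_domination_number e <= annihilation_number e).
Proof.
have [sym_e irr_e] := simple_e.
have deg2 x : 2 <= degree e x by rewrite -min_degree_e min_degree_le.
set g := total_domination_number e; set m := graph_size e.
set n := graph_order e; set ds := degree_seq e; set a := annihilation_number e.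
pose n2 := count (pred1 2) ds.
have n2E : \sum_x (degree e x == 2) = n2.
  by rewrite -(big_degree_seq e (fun k => k == 2 : nat)) /n2 -sumn_count sumnE big_map.
have sum_ds : sumn ds = 2 * m.
  by rewrite sumnE (big_degree_seq e id) sum_degree.
have size_ds : size ds = n by rewrite size_sort size_map -cardE.
have cov : #|cover (neighborhoods e)| <= n by apply: max_card.
have szN : {in neighborhoods e, forall f : {set T}, 1 < #|f|}.
  by move=> f /neighborhoodsP[x ->]; apply: deg2.
have boundQ : 2 * g <= m + 2.
  have [D /total_domination_number_le leD le2] :=
    total_domination_size sym_e irr_e connected_e nontrivial_e deg2.
  by apply: leq_trans le2; rewrite leq_mul2l.
have sum_cm : \sum_x cm_weight (degree e x) = n + n2.
  by rewrite -n2E /n /graph_order -sum1_card -big_split.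
have sum_mark : 3 * n + \sum_x mark_weight (degree e x) = 2 * (2 * m) + 4 * n2.
  rewrite -sum_degree // -n2E /n /graph_order mulnC -sum_nat_const !big_distrr -!big_split.
  apply: eq_bigr => x _ /=; have := deg2 x; rewrite /mark_weight.
  by case: eqP => [->|_] //; clear; lia.
have boundR : 4 * g <= 2 * n + n2.
  have [D /hitting_neighborhoods/total_domination_number_le leD le4] := hitting_cm szN.
  have := sum_neighborhoods e cm_weight; rewrite sum_cm; move: leD le4 cov.
  by rewrite -/g; clear; lia.
have boundP : 3 * g <= m + n2.
  have /card_gt0P[u _] : 0 < #|T| := ltnW nontrivial_e.
  have /card_gt0P[v] : 0 < degree e u := ltnW (deg2 u).
  rewrite inE => uv.
  have uv_neq : u != v by apply: contraTneq uv => ->; rewrite irr_e.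
  have [D /hitting_neighborhoods/total_domination_number_le leD] :=
    hitting_marks szN (marks_neighborhoods connected_e sym_e uv).
  (* Altogether [12 g <= 4 m + 4 n2 + 2], and the 2 disappears modulo 4. *)
  have := sum_neighborhoods e mark_weight; rewrite cards2 uv_neq /potential.
  by move: leD cov sum_mark; rewrite -/g; clear; lia.
have gn : g <= n.
  apply: leq_trans (max_card [set: T]); apply: total_domination_number_le.
  apply/forallP => x; apply/exists_inP; have /card_gt0P[y] := ltnW (deg2 x).
  by rewrite inE => xy; exists y; rewrite ?inE.
(* Once [a < n], the entry [c] of index [a] is a genuine degree and not the default 0. *)
have [na|an] := leqP n a.
  by have ga := leq_trans gn na; split=> //; rewrite (leq_trans ga) ?leq_addr.
pose c := nth 0 ds a; pose t := take a.+1 ds; pose u := drop a.+1 ds.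
have size_t : size t = a.+1 by rewrite size_takel ?size_ds.
(* Otherwise [a + 1] would be admissible in the maximum defining [a]. *)
have gt_m : m < sumn t.
  rewrite ltnNge -sum_nth_take ?size_ds //; apply/negP => le_m.
  have lt_n : a.+1 < n.+1 by [].
  pose admissible (k : 'I_n.+1) := \sum_(i < k) nth 0 (degree_seq e) i <= graph_size e.
  have := @leq_bigmax_cond _ admissible (@nat_of_ord _) (Ordinal lt_n) le_m.
  by rewrite leqNgt ltnS leqnn.
have sum_tu : sumn t + sumn u = 2 * m by rewrite -sum_ds -sumn_cat cat_take_drop.
have size_tu : n = a.+1 + size u by rewrite -size_t -size_cat cat_take_drop.
have sorted_ds : sorted leq ds := sort_sorted leq_total _.
have le_nth i j : i <= j -> j < n -> nth 0 ds i <= nth 0 ds j.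
  move=> ij jn; apply: (sorted_leq_nth leq_trans leqnn 0 sorted_ds) => //.
    by rewrite inE size_ds (leq_ltn_trans ij).
  by rewrite inE size_ds.
have ds2 k : k \in ds -> 1 < k.
  by rewrite mem_sort => /mapP[x _ ->].
have t_le : all (fun k => 1 < k <= c) t.
  apply/(all_nthP 0) => i; rewrite size_t => ia; rewrite nth_take //.
  by rewrite ds2 ?le_nth // mem_nth // size_ds (leq_trans ia).
have u_ge : all (leq c) u.
  apply/(all_nthP 0) => i; rewrite size_drop size_ds ltn_subRL => iu.
  by rewrite nth_drop le_nth // (leq_trans (leqnSn a)) ?leq_addr.
have count_t : 2 < c -> count (pred1 2) t = n2.
  move=> c3; rewrite /n2 -[ds](cat_take_drop a.+1) count_cat -/t -/u.
  suff /eqP -> : count (pred1 2) u == 0 by rewrite addn0.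
  rewrite -leqn0 leqNgt -has_count; apply/hasPn => k /(allP u_ge) ck /=.
  by rewrite neq_ltn (leq_trans c3 ck) orbT.
have strong : 2 < c -> g <= a.
  move=> c3; have := sumn_le_cutoff c3 t_le; rewrite count_t // size_t => le_t.
  have [c4|c_le3] := ltnP 3 c.
    have := sumn_ge_cutoff u_ge; rewrite (_ : sumn u = 2 * m - sumn t); last first.
      by rewrite -sum_tu addKn.
    move=> le_u; rewrite -ltnS; apply: cutoff_contradiction c4 le_t le_u gt_m _.
    by rewrite -size_tu.
  (* Now [3 g <= m + n2 < sumn t + n2 <= 3 (a + 1)]. *)
  have c_eq : c = 3 by apply/eqP; rewrite eqn_leq c_le3.
  by move: le_t gt_m boundP; rewrite c_eq; clear; lia.
split=> //; have [/strong ga|c2] := ltnP 2 c; first by rewrite (leq_trans ga) ?leq_addr.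
(* With cutoff at most 2, [2 g <= m + 2 < 2 (a + 1) + 2]. *)
have : sumn t <= 2 * a.+1.
  rewrite -size_t; elim: (t) t_le => [|k s IHs] //= /andP[/andP[_ kc] /IHs].
  by rewrite mulnS; apply: leq_add; apply: leq_trans c2.
by move: gt_m boundQ; clear; lia.
Qed.
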